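(* Let $\Sigma$ be the set of monoid identities $$\Sigma:=\{\mathbf{w}_n\approx\mathbf{w}_n'\mid n\geq 2\}\cup\{xt_1xt_2x\approx x^3t_1t_2\approx t_1t_2x^3,\ x^3\approx x^4\},$$ and let $\mathscr{V}$ be the set of $37$ words, both described in the context. Then $\Sigma$ is an identity basis for the monoid identities of the finite monoid $\mathbf{M}(\mathscr{V})$; that is, for every monoid identity $\mathbf{u}\approx\mathbf{v}$, $\mathbf{M}(\mathscr{V})$ satisfies $\mathbf{u}\approx\mathbf{v}$ if and only if $\mathbf{u}\approx\mathbf{v}$ is a consequence of $\Sigma$.
   Context: Monoids are algebras in the signature $\{\cdot,1\}$. $\mathscr{A}$ is a countably infinite alphabet of variables and $\mathscr{A}^*$ is the free monoid over it. A monoid identity is an expression $\mathbf{u}\approx\mathbf{v}$ with $\mathbf{u},\mathbf{v}\in\mathscr{A}^*$; a monoid $\mathbf{M}$ satisfies it if $\mathbf{u}\theta=\mathbf{v}\theta$ for every substitution $\theta:\mathscr{A}\to\mathbf{M}$. An identity is a consequence of $\Sigma$ if every monoid satisfying $\Sigma$ satisfies it (equivalently, it is derivable from $\Sigma$ in equational logic). The words $\mathbf{w}_n,\mathbf{w}_n'$: with $x,y,z_1,z_2,t_1,t_2,x_0,x_1,\dots$ distinct variables, for $n\ge 2$, $\mathbf{w}_n:=x_0z_1xyz_2\,x_1x_0x_2x_1x_3x_2\cdots x_nx_{n-1}\,z_1xyz_2x_n$, where the middle segment is the product over $i=1,\dots,n$ (in increasing order) of $x_ix_{i-1}$, and $\mathbf{w}_n'$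 is obtained by switching the positions of $x$ and $y$: $\mathbf{w}_n':=x_0z_1yxz_2\,x_1x_0x_2x_1x_3x_2\cdots x_nx_{n-1}\,z_1yxz_2x_n$. The chain $xt_1xt_2x\approx x^3t_1t_2\approx t_1t_2x^3$ abbreviates two identities. For a set $\mathscr{W}\subseteq\mathscr{A}^*$, let $\mathscr{W}^{\leq}$ be the set of all (contiguous) subwords, i.e. factors, of words in $\mathscr{W}$ (including the empty word), and let $I(\mathscr{W})=\mathscr{A}^*\setminus\mathscr{W}^{\leq}$, an ideal of $\mathscr{A}^*$. Then $\mathbf{M}(\mathscr{W})$ is the Rees quotient monoid $\mathscr{A}^*/I(\mathscr{W})$ (so its elements are the words in $\mathscr{W}^{\leq}$ together with $0$; the product of two words is their concatenation if this lies in $\mathscr{W}^{\leq}$, and $0$ otherwise). The set $\mathscr{V}$ (with $a,b,c,d,e,t,x,y,z$ distinct variables) consists of the following $37$ words: - the three words $xxyy$, $xyzyxz$, $zxyzyx$; - the six words $xyabbaxy$, $axybcabxyc$, $abxyacbdxycd$, $xyabcadbecdexy$, $xydcdabcaebexy$, $dxycdabcaebxye$ (each of which equals its own reverse up to a change of letter names); - the fourteen words $atxyaxy$, $abaxybxy$, $abxyaxyb$, $abbxyaxy$, $abxybaxy$, $abxyacbcxy$, $axybcbacxy$, $axybbcacxy$, $axybbaccxy$, $axybbacxyc$, $axybcabdcxyd$, $abxyacbddxyc$, $axybcabdcdxy$, $dxycdabcaebexy$, together with the reverses (words read from right to left) of these fourteen words. *)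

(* Defs.v *)
From HB Require Import structures.
From mathcomp Require Import all_boot.

Set Implicit Arguments.
Unset Strict Implicit.
Unset Printing Implicit Defensive.

(* The alphabet is [nat]; the free monoid over it is [seq nat] with [++]. *)
Definition word := seq nat.

Definition identity := (word * word)%type.

(* A monoid is an arbitrary carrier with a [Monoid.law] on it (rather than a
   [monoidType], which would carry an extra choice structure), so that
   [consequence] really ranges over all monoids. *)
Definition eval (M : Type) (one : M) (mul : Monoid.law one)
    (theta : nat -> M) (u : word) : M :=
  \big[mul/one]_(i <- u) theta i.

Definition satisfies (M : Type) (one : M) (mul : Monoid.law one)
    (e : identity) : Prop :=
  forall theta : nat -> M, eval mul theta e.1 = eval mul theta e.2.

Definition consequence (Sigma : identity -> Prop) (e : identity) : Prop :=
  forall (M : Type) (one : M) (mul : Monoid.law one),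
    (forall e', Sigma e' -> satisfies mul e') -> satisfies mul e.

(* The Rees quotient M(W), for a finite set W of words given as a sequence:
   [None] is the zero, [Some w] is the subword w of a word in W. *)
Section ReesQuotient.

Variable W : seq word.

Definition subword (w : word) : bool := (w == [::]) || has (infix w) W.

Definition rees : Type := option {w : word | subword w}.

Lemma subword_nil : subword [::].
Proof. by []. Qed.

Definition rees_one : rees := Some (Sub [::] subword_nil).

Definition rees_mul (p q : rees) : rees :=
  if (p, q) is (Some u, Some v) then insub (val u ++ val v) else None.

Lemma subword_infix (s p t : word) : subword (s ++ p ++ t) -> subword p.
Proof.
case/orP => [/eqP/(congr1 size)/eqP | /hasP[w wW /infixP[s' [t' w_eq]]]].
  by rewrite !size_cat !addn_eq0 => /and3P[_ /nilP-> _].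
apply/orP; right; apply/hasP; exists w => //; apply/infixP.
by exists (s' ++ s), (t ++ t'); rewrite w_eq -!catA.
Qed.

Lemma rees_mulA : associative rees_mul.
Proof.
move=> [[u hu]|] [[v hv]|] [[w hw]|] //=; rewrite /rees_mul /=; last first.
  by case: insub.
case: (insubP _ (v ++ w)) => [vw _ /= vwE|/negbTE nvw];
case: (insubP _ (u ++ v)) => [uv _ /= uvE|/negbTE nuv] //=.
- by rewrite vwE uvE catA.
- rewrite vwE insubN //; apply: contraFN nuv => huvw.
  by apply: (@subword_infix [::] _ w); rewrite /= -catA.
- rewrite uvE insubN //; apply: contraFN nvw => huvw.
  by apply: (@subword_infix u _ [::]); rewrite cats0 catA.
Qed.

Lemma rees_mul1 : left_id rees_one rees_mul.
Proof. by move=> [u|] //; rewrite /rees_mul /= valK. Qed.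

Lemma rees_mulr1 : right_id rees_one rees_mul.
Proof. by move=> [u|] //; rewrite /rees_mul /= cats0 valK. Qed.

HB.instance Definition _ :=
  Monoid.isLaw.Build rees rees_one rees_mul rees_mulA rees_mul1 rees_mulr1.

Definition rees_monoid : Monoid.law rees_one := rees_mul.

Definition subwords : seq word :=
  [::] :: [seq take p.2 (drop p.1 w) |
             w <- W, p <- [seq (i, j) | i <- iota 0 (size w).+1,
                                        j <- iota 0 (size w).+1]].

Lemma subword_subwords w : subword w -> w \in subwords.
Proof.
case/orP => [/eqP->|/hasP[v vW /infixP[s [t v_eq]]]]; first exact: mem_head.
rewrite inE; apply/orP; right; apply/allpairsPdep.
exists v, (size s, size w); split=> //; last first.
  by rewrite v_eq drop_size_cat // take_size_cat.
apply/allpairsP; exists (size s, size w).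
split=> //; rewrite mem_iota ltnS v_eq !size_cat ?leq_addr //.
by rewrite addnCA leq_addr.
Qed.

Lemma rees_finite : exists s : seq rees, forall p, p \in s.
Proof.
exists (None :: map insub subwords) => -[u|]; last exact: mem_head.
rewrite inE; apply/orP; right; apply/mapP; exists (val u); last by rewrite valK.
exact/subword_subwords/(valP u).
Qed.

End ReesQuotient.

Section Sigma.

Local Notation x := 0.
Local Notation y := 1.
Local Notation z1 := 2.
Local Notation z2 := 3.
Local Notation t1 := 4.
Local Notation t2 := 5.
Local Notation xs i := (6 + i).

Definition w_pattern (p q n : nat) : word :=
  [:: xs 0; z1; p; q; z2]
    ++ flatten [seq [:: xs i; xs i.-1] | i <- iota 1 n]
    ++ [:: z1; p; q; z2; xs n].

Definition w_ (n : nat) : word := w_pattern x y n.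
Definition w'_ (n : nat) : word := w_pattern y x n.

Inductive Sigma : identity -> Prop :=
| Sigma_w n : 2 <= n -> Sigma (w_ n, w'_ n)
| Sigma_xtxtx : Sigma ([:: x; t1; x; t2; x], [:: x; x; x; t1; t2])
| Sigma_xxxtt : Sigma ([:: x; x; x; t1; t2], [:: t1; t2; x; x; x])
| Sigma_x3x4 : Sigma ([:: x; x; x], [:: x; x; x; x]).

End Sigma.

Section Words.

Local Notation a := 0.
Local Notation b := 1.
Local Notation c := 2.
Local Notation d := 3.
Local Notation e := 4.
Local Notation t := 5.
Local Notation x := 6.
Local Notation y := 7.
Local Notation z := 8.

Definition V3 : seq word :=
  [:: [:: x; x; y; y];
      [:: x; y; z; y; x; z];
      [:: z; x; y; z; y; x] ].

Definition V6 : seq word :=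
  [:: [:: x; y; a; b; b; a; x; y];
      [:: a; x; y; b; c; a; b; x; y; c];
      [:: a; b; x; y; a; c; b; d; x; y; c; d];
      [:: x; y; a; b; c; a; d; b; e; c; d; e; x; y];
      [:: x; y; d; c; d; a; b; c; a; e; b; e; x; y];
      [:: d; x; y; c; d; a; b; c; a; e; b; x; y; e] ].

Definition V14 : seq word :=
  [:: [:: a; t; x; y; a; x; y];
      [:: a; b; a; x; y; b; x; y];
      [:: a; b; x; y; a; x; y; b];
      [:: a; b; b; x; y; a; x; y];
      [:: a; b; x; y; b; a; x; y];
      [:: a; b; x; y; a; c; b; c; x; y];
      [:: a; x; y; b; c; b; a; c; x; y];
      [:: a; x; y; b; b; c; a; c; x; y];
      [:: a; x; y; b; b; a; c; c; x; y];
      [:: a; x; y; b; b; a; c; x; y; c];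
      [:: a; x; y; b; c; a; b; d; c; x; y; d];
      [:: a; b; x; y; a; c; b; d; d; x; y; c];
      [:: a; x; y; b; c; a; b; d; c; d; x; y];
      [:: d; x; y; c; d; a; b; c; a; e; b; e; x; y] ].

Definition V : seq word := V3 ++ V6 ++ V14 ++ map rev V14.

End Words.

(* Main.v *)
Require Import Defs.
From mathcomp Require Import all_boot zify.

(** Evaluating a word in M(V) amounts to substituting words for its letters and
    testing whether the result is a factor of a word of V ([satisfies_reesP]).

    Soundness.  A nontrivial instance of w_n contains a factor T of length at
    least two twice, in the form X0 T m T Xn with m = X1 X0 X2 X1 ... Xn X(n-1);
    such an m is called a chain from X0 to Xn.  A finite computation shows that
    no word of V has such a factor.  The other identities of Sigma hold since no
    letter occurs three times in a word of V.

    Completeness.  By the identities with x^3, all occurrences of a letter that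
    occurs at least three times can be collected into a cube at the front, so
    consider words u and v in which every letter occurs at most twice, where
    M(V) satisfies u = v.  If u, restricted to some letters, is a factor of a
    word of V up to renaming, then so is v, restricted to the same letters, and
    the two restrictions are equal ([isoterm_restrict]).  Applied to two letters
    this shows that x and y can be ordered differently in u and v only if they
    alternate, as in xyxy and yxyx.  Now u is sorted into v by moving letters to
    the left, one transposition at a time ([move_left]); each step exchanges the
    adjacent first occurrences of two letters x and y, the second occurrences of
    which then turn out to be adjacent too, so u = A xy B xy C ([flip_blocks]).
    It remains to derive from Sigma that both factors xy may be turned into yx.

    The long words of V are exactly the obstacles to this.  That none of them is
    a restriction of A xy B xy C forces A = A' X0 Z1, B = Z2 m Z1 and
    C = Z2 Xn C', where m is a chain from X0 to Xn ([tight_decomposition]), and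
    the exchange is an instance of w_n.  To find the chain, strip the longest
    common suffix Z1 and prefix Z2, and read X0 m Xn as the history of a queue,
    where a letter enters at its first occurrence and leaves at its second.  The
    obstructions say that the queue discipline is respected, and that no three
    letters are in the queue together such that the first is separated from the
    second and the second from the third; here two letters are separated if
    something stands between their first or between their second occurrences.
    Hence unseparated letters form blocks X0, X1, ..., Xn, each of which has
    left before the next but one enters ([state_chain]). *)

Set Implicit Arguments.
Unset Strict Implicit.
Unset Printing Implicit Defensive.

(** * Subsequences and occurrences *)

Lemma subseq_catP (s t1 t2 : word) :
  subseq s (t1 ++ t2) ->
  exists2 i, i <= size s & subseq (take i s) t1 /\ subseq (drop i s) t2.
Proof.
elim: t1 s => [|b t1 IH] [|a s] /=; try by move=> *; exists 0; rewrite ?sub0seq.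
case: eqVneq => [->|ab] st.
  by have [i is_ [s1 s2]] := IH _ st; exists i.+1; rewrite //= eqxx.
have [[|i] is_ [s1 s2]] := IH _ st; first by exists 0.
by exists i.+1; rewrite //= (negbTE ab).
Qed.

Lemma subseq_insert (s t : word) r : subseq s t -> r \in t -> r \notin s ->
  exists2 i, i <= size s & subseq (take i s ++ r :: drop i s) t.
Proof.
move=> st rt rs; have [t1 [t2 t_eq]] : exists t1 t2, t = t1 ++ r :: t2.
  by case/splitPr: rt => t1 t2; exists t1, t2.
move: st; rewrite t_eq => /subseq_catP[i is_ [s1 s2]]; exists i => //.
apply: cat_subseq => //=; rewrite eqxx.
case: (drop i s) s2 (mem_subseq (drop_subseq s i)) => [|a s' /= as' dr].
  by move=> _ _; apply: sub0seq.
by move: as'; case: eqP => // ar; rewrite -ar dr ?mem_head in rs.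
Qed.

Lemma subseq_rcons_neq (s t : word) a r : a != r ->
  subseq (rcons s a) (rcons t r) = subseq (rcons s a) t.
Proof.
move=> ar; rewrite -subseq_rev !rev_rcons /= (negbTE ar).
by rewrite -rev_rcons subseq_rev.
Qed.

Lemma common_prefix (s t : word) : exists z s' t',
  [/\ s = z ++ s', t = z ++ t' &
      forall a s2 b t2, s' = a :: s2 -> t' = b :: t2 -> a != b].
Proof.
elim: s t => [|a s IH] [|b t]; try by exists [::]; do 2!eexists; split.
have [->|ab] := eqVneq a b; last first.
  by exists [::], (a :: s), (b :: t); split=> // ? ? ? ? [<- _] [<- _].
by have [z [s' [t' [-> -> h]]]] := IH t; exists (b :: z), s', t'.
Qed.

Lemma not_thrice (a : nat) (s : word) :
  count_mem a s <= 2 -> ~~ subseq [:: a; a; a] s.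
Proof.
move=> c2; apply/negP => /(leq_count_subseq (pred1 a)).
by move=> /leq_trans/(_ c2); rewrite /= eqxx.
Qed.

Lemma mem_other (a : nat) (s1 s2 : word) :
  count_mem a (s1 ++ a :: s2) = 2 -> a \in s1 \/ a \in s2.
Proof.
rewrite count_cat /= eqxx => c2.
case: (boolP (a \in s1)) => [|/count_memPn n1]; first by left.
by right; move: c2; rewrite n1 add0n add1n -has_pred1 has_count => -[->].
Qed.

Lemma uniq_subseq2 (s : word) : (forall c, ~~ subseq [:: c; c] s) -> uniq s.
Proof.
elim: s => // a s IH h; apply/andP; split.
  by have := h a; rewrite /= eqxx sub1seq.
apply: IH => c; apply: contra (h c) => cs.
exact: subseq_trans cs (subseq_cons s a).
Qed.

(** * Chains, queues and obstructions *)

(** [chain X0 m Xn] is m = X1 X0 X2 X1 ... Xn X(n-1), the shape of the middle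
    part of the identity w_n under a substitution; the empty word is the case
    n = 0, where X0 = Xn. *)
Inductive chain : word -> word -> word -> Prop :=
| chain_nil P : chain P [::] P
| chain_step P X w Q : chain X w Q -> chain P (X ++ P ++ w) Q.

Definition pattern := (word * word * word)%type.

(** A pattern (p, q, r) is to be found in three consecutive words at once.  The
    renaming [f] is injective on the pattern automatically wherever [avoid] is
    used: the letters of a pattern occur twice in it, and no letter occurs more
    than twice in [P ++ w ++ Q]. *)
Definition avoid (gs : seq pattern) (P w Q : word) := forall g (f : nat -> nat),
  g \in gs -> subseq (map f g.1.1) P -> subseq (map f g.1.2) w ->
  subseq (map f g.2) Q -> False.

Section Patterns.

Local Notation a := 0.
Local Notation b := 1.
Local Notation c := 2.
Local Notation d := 3.
Local Notation e := 4.

(** Here (p, q, r) stands for the word p xy q xy r.  Up to renaming, these and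
    their reversals are the words of V in which a factor of length two is
    repeated, other than atxyaxy and its reversal. *)
Definition half_obstructions : seq pattern :=
  [:: ([:: a; b; a], [:: b], [::]);
      ([:: a; b], [:: a], [:: b]);
      ([:: a; b; b], [:: a], [::]);
      ([:: a; b], [:: b; a], [::]);
      ([:: a], [:: b; c; b; a; c], [::]);
      ([:: a], [:: b; b; c; a; c], [::]);
      ([:: a], [:: b; b; a; c; c], [::]);
      ([:: a], [:: b; b; a; c], [:: c]);
      ([:: a; b], [:: a; c; b; d; d], [:: c]);
      ([:: a; b], [:: a; c; b; d], [:: c; d]);
      ([::], [:: a; b; b; a], [::]);
      ([:: a; b], [:: a; c; b; c], [::]);
      ([:: a], [:: b; c; a; b], [:: c]);
      ([:: a], [:: b; c; a; b; d; c], [:: d]);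
      ([:: a], [:: b; c; a; b; d; c; d], [::]);
      ([::], [:: a; b; c; a; d; b; e; c; d; e], [::]);
      ([::], [:: d; c; d; a; b; c; a; e; b; e], [::]);
      ([:: d], [:: c; d; a; b; c; a; e; b; e], [::]);
      ([:: d], [:: c; d; a; b; c; a; e; b], [:: e]) ].

Definition mirror (g : pattern) : pattern := (rev g.2, rev g.1.2, rev g.1.1).

Definition obstructions := half_obstructions ++ map mirror half_obstructions.

(** The patterns to avoid in a state of the queue.  The first four say that the
    letters in the queue at either boundary are not separated inside; in each
    of the others three letters are in the queue together, and both the first
    two and the last two of them are separated, by a letter or a boundary. *)
Definition queue_obstructions : seq pattern :=
  [:: ([:: a; b], [:: a; c; b; c], [::]);
      ([:: a; b], [:: a; c; b], [:: c]);
      ([::], [:: c; a; c; b], [:: a; b]);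
      ([:: c], [:: a; c; b], [:: a; b]);
      ([:: a], [:: b; c; a; b], [:: c]);
      ([:: a], [:: b; c; a; b; d; c; d], [::]);
      ([:: a], [:: b; c; a; b; d; c], [:: d]);
      ([:: a], [:: b; a; c; d; b; c], [:: d]);
      ([::], [:: d; c; d; b; a; c; b], [:: a]);
      ([::], [:: a; b; c; a; d; b; e; c; d; e], [::]);
      ([::], [:: d; c; d; a; b; c; a; e; b; e], [::]);
      ([:: d], [:: c; d; a; b; c; a; e; b; e], [::]);
      ([::], [:: d; c; d; a; b; c; a; e; b], [:: e]);
      ([:: d], [:: c; d; a; b; c; a; e; b], [:: e]) ].

End Patterns.

Definition fifo (s : word) := forall a b, ~~ subseq [:: a; b; b; a] s.

Definition all_twice (s : word) := forall a, a \in s -> count_mem a s = 2.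

(** A moment in the history of the queue: the letters of [P] are waiting, [w] is
    still to come, and the letters of [Q] leave after [w].  The conditions are
    chosen to be passed on from block to block. *)
Record state (P w Q : word) : Prop := State {
  state_uniqP : uniq P;
  state_uniqQ : uniq Q;
  state_twice : all_twice (P ++ w ++ Q);
  state_fifo : fifo (P ++ w ++ Q);
  state_avoid : avoid queue_obstructions P w Q;
  state_sub : w != [::] -> {subset P <= w} }.

Lemma all_twice_le2 s a : all_twice s -> count_mem a s <= 2.
Proof.
by move=> h; case: (boolP (a \in s)) => [/h->|/count_memPn->].
Qed.

Lemma fifo_sub s t : subseq s t -> fifo t -> fifo s.
Proof. by move=> st ft a b; apply: contra (ft a b) => /subseq_trans; apply. Qed.

(** In a queue the order of entering is the order of leaving: at the first place
    where the two words differ, the letters of one pair would be nested. *)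
Lemma fifo_eq (P Q : word) :
  uniq P -> uniq Q -> P =i Q -> fifo (P ++ Q) -> P = Q.
Proof.
elim: P Q => [|a P IH] [|b Q] //=.
- by move=> _ _ /(_ b); rewrite mem_head.
- by move=> _ _ /(_ a); rewrite mem_head.
move=> /andP[aP uP] /andP[bQ uQ] PQ ff.
have [ab|ab] := eqVneq a b.
  rewrite -ab in PQ ff bQ *; congr (_ :: _); apply: IH => //.
    move=> c; have := PQ c; rewrite !inE; case: eqP => // -> _.
    by rewrite (negbTE aP) (negbTE bQ).
  apply: fifo_sub ff; apply: (@cat_subseq _ _ _ (a :: P)); exact: subseq_cons.
case/negP: (ff a b); apply: (@cat_subseq _ [:: a; b] [:: b; a] (a :: P) (b :: Q)).
  by rewrite /= eqxx sub1seq; have := PQ b; rewrite !inE eqxx /= eq_sym (negbTE ab).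
by rewrite /= eqxx sub1seq; have := PQ a; rewrite !inE eqxx /= (negbTE ab).
Qed.

Lemma subseq_skip (a : nat) s t : subseq s t -> subseq s (a :: t).
Proof. by move/subseq_trans; apply; apply: subseq_cons. Qed.

Lemma subseq_keep (a : nat) s t : subseq s t -> subseq (a :: s) (a :: t).
Proof. by rewrite /= eqxx. Qed.

Lemma subseq_skipcat (s l t : word) : subseq s t -> subseq s (l ++ t).
Proof. by move/subseq_trans; apply; apply: suffix_subseq. Qed.

Lemma subseq_take k (s s1 l t : word) : subseq s1 l ->
  subseq (take k s) s1 -> subseq (drop k s) t -> subseq s (l ++ t).
Proof.
move=> sl tk dr; rewrite -(cat_take_drop k s).
exact: cat_subseq (subseq_trans tk sl) dr.
Qed.

Lemma subseq_mem_cat (a : nat) s l t :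
  a \in l -> subseq s t -> subseq (a :: s) (l ++ t).
Proof. by rewrite -sub1seq => al st; apply: (@cat_subseq _ [:: a] s). Qed.

(** Proves goals [subseq s t] where [t] is a concatenation of letters and words
    about which the context has facts [a \in l] or [subseq s l].  Matching a
    letter with an equal letter as early as possible loses nothing, so the only
    backtracking is over what a word [l] absorbs. *)
Ltac find_subseq_rec :=
  lazymatch goal with
  | |- is_true (subseq [::] _) => exact: sub0seq
  | |- is_true (subseq (?x :: _) (?x :: _)) => apply: subseq_keep; find_subseq_rec
  | |- is_true (subseq _ (_ :: _)) => apply: subseq_skip; find_subseq_rec
  | |- is_true (subseq _ (_ ++ _)) =>
    match goal with
    | H : is_true (subseq (_ :: _) ?l) |- is_true (subseq _ (?l ++ _)) =>
      let go k := (apply: (@subseq_take k _ _ _ _ H);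
                   simpl take; simpl drop; find_subseq_rec) in
      first [go 5 | go 4 | go 3 | go 2 | go 1]
    | H : is_true (?x \in ?l) |- is_true (subseq (?x :: _) (?l ++ _)) =>
      apply: (subseq_mem_cat H); find_subseq_rec
    | |- _ => apply: subseq_skipcat; find_subseq_rec
    end
  | |- is_true (subseq _ _) =>
    match goal with
    | H : is_true (subseq ?s ?l) |- is_true (subseq _ ?l) =>
      apply: subseq_trans H; find_subseq_rec
    | H : is_true (?x \in ?l) |- is_true (subseq [:: ?x] ?l) =>
      rewrite sub1seq; exact: H
    end
  end.

Ltac find_subseq := repeat rewrite -?catA ?cat_cons ?cats0 ?cat0s; find_subseq_rec.

(** Closes the goal by finding a pattern forbidden by [av], the letters a, b, ...
    of the pattern being instantiated by the list [L]. *)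
Ltac violate av L :=
  let rec try_all Gs :=
    lazymatch Gs with
    | ?g :: ?Gs' =>
      first [ (apply: (av g (nth 0 L)); [by [] | | | ];
               cbv [map nth fst snd]; find_subseq)
            | try_all Gs' ]
    end in
  lazymatch type of av with
  | avoid ?Gs _ _ _ => let Gs' := eval cbv in Gs in try_all Gs'
  end.

(** * From a queue to a chain *)

Lemma state_nil P Q : state P [::] Q -> P = Q.
Proof.
case=> uP uQ tw ff _ _; apply: fifo_eq => // a.
have mem_cat2 : a \in P ++ Q -> (a \in P) && (a \in Q).
  move/tw; rewrite count_cat !count_uniq_mem //.
  by case: (a \in P); case: (a \in Q).
move: mem_cat2; rewrite mem_cat.
by case: (a \in P); case: (a \in Q) => // /(_ isT).
Qed.

(** The waiting letters leave in order, and without interruption: a letter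
    between two of them would be nested with one of them if it were leaving,
    and would separate them if it were entering. *)
Lemma state_split p P w Q : state (p :: P) w Q -> w != [::] ->
  exists X w', w = X ++ (p :: P) ++ w'.
Proof.
case=> uP _ tw ff av sub w0; have {}sub := sub w0.
have thr (a : nat) := not_thrice (all_twice_le2 a tw).
have pw : p \in w by rewrite sub ?mem_head.
case/splitPr: pw => X w1 in tw ff av sub thr {w0} *.
(* [z] is the part of [P] that has left without interruption; the letter [s]
   that comes instead of the next letter [q] is found to be impossible *)
have [z [P3 [w3 [P_eq w1_eq neq]]]] := common_prefix P w1.
case: P3 => [|q P3] in P_eq neq *; last exfalso.
  by exists X, w3; rewrite w1_eq P_eq cats0.
have qw3 : q \in w3.
  have := sub q; rewrite w1_eq P_eq !(mem_cat, inE) eqxx !orbT.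
  move=> /(_ isT)/or4P[qX|/eqP qp|qz|//].
  - case/negP: (ff p q); rewrite P_eq; find_subseq.
  - by move: uP; rewrite P_eq -qp /= mem_cat inE eqxx orbT.
  - by move: uP; rewrite P_eq /= cat_uniq /= qz andbF andbF.
case: w3 => // s w4 in w1_eq neq qw3.
have qs : q != s by apply: neq.
have qw4 : q \in w4 by move: qw3; rewrite inE (negbTE qs).
subst P w1.
have {}tw :
    count_mem s ((p :: z ++ q :: P3 ++ X ++ p :: z) ++ s :: w4 ++ Q) = 2.
  move: (tw s); rewrite !(mem_cat, inE) eqxx !orbT => /(_ isT) <-.
  by repeat rewrite -?catA ?cat_cons.
case/mem_other: tw; rewrite !(mem_cat, inE) => /orP.
  case=> [/eqP sp|/or4P[sz|/eqP/esym/eqP|sP3|/or3P[sX|/eqP sp|sz]]].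
  - by case/negP: (thr s); rewrite sp; find_subseq.
  - by case/negP: (thr s); find_subseq.
  - by rewrite (negbTE qs).
  - by case/negP: (ff q s); find_subseq.
  - by case/negP: (ff q s); find_subseq.
  - by case/negP: (thr s); rewrite sp; find_subseq.
  - by case/negP: (thr s); find_subseq.
case=> [sw4|sQ]; last by violate av [:: p; q; s].
have qsub : subseq [:: q] w4 by rewrite sub1seq.
have [|i _] := subseq_insert qsub sw4; first by rewrite inE eq_sym.
case: i => [|i] /= sqw4; first by case/negP: (ff q s); find_subseq.
by violate av [:: p; q; s].
Qed.

(** Once the block [P] has left, its letter [p] is a witness of separation: a
    pattern in the new state in which a letter of [X] is cut off by the boundary
    becomes, with the two occurrences of [p] around [X], a pattern without that
    boundary in the old state. *)
Lemma state_step (p : nat) (P X w Q : word) :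
  p \in P -> state P (X ++ P ++ w) Q -> state X w Q.
Proof.
move=> pP [uP uQ tw ff av sub].
have thr (a : nat) := not_thrice (all_twice_le2 a tw).
have uX : uniq X.
  by apply: uniq_subseq2 => c; apply/negP => cX; case/negP: (ff p c); find_subseq.
have ff' : fifo (X ++ w ++ Q).
  apply: fifo_sub ff; rewrite -!catA; apply: subseq_skipcat.
  exact: cat_subseq (subseq_refl X) (suffix_subseq _ _).
have tw' : all_twice (X ++ w ++ Q).
  move=> a aT; have := tw a; rewrite !count_cat !mem_cat.
  have -> : count_mem a P = 0.
    apply/count_memPn/negP => aP; case/negP: (thr a).
    move: aT; rewrite !mem_cat => /or3P[aX|aw|aQ]; find_subseq.
  by move: aT; rewrite !mem_cat => /or3P[]->; rewrite ?orbT /= => /(_ isT); lia.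
split=> //.
{ move=> g f; rewrite !inE.
  repeat (case/orP=> [/eqP->|]); last move/eqP->.
  all: move=> s1 s2 s3; cbv [map fst snd] in s1, s2, s3.
  all: try by violate av [:: f 0; f 1; f 2; f 3; f 4].
  all: try by violate av [:: p; f 0; f 1; f 2; f 3; f 4].
  all: try by violate av [:: f 1; f 2; f 0; p; f 3].
  by violate av [:: f 3; f 2; f 1; f 0]. }
(* a letter [a] of [X] that is still waiting at the end of a nonempty [w] is
   separated by [p] from the first letter [c] of [w] *)
case: w => // c w in ff av sub tw thr ff' tw' * => _ a aX.
apply: contraT => aw; exfalso.
have aQ : a \in Q.
  have := tw' a; rewrite !(mem_cat, count_cat) aX (count_uniq_mem a uX) aX.
  by move=> /(_ isT); rewrite (count_memPn aw) count_uniq_mem //; case: (a \in Q).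
have ac : a != c by move: aw; rewrite inE negb_or => /andP[].
case: (@mem_other c X (w ++ Q)) => [|cX|].
- by apply: tw'; rewrite !(mem_cat, inE) eqxx orbT.
- have aX' : subseq [:: a] X by rewrite sub1seq.
  have [|[|i] _ /= acX] := subseq_insert aX' cX; first by rewrite inE eq_sym.
    by violate av [:: p; c; a].
  by case/negP: (ff a c); find_subseq.
rewrite mem_cat => /orP[cw|cQ]; first by case/negP: (ff a c); find_subseq.
have aQ' : subseq [:: a] Q by rewrite sub1seq.
have [|[|i] _ /= acQ] := subseq_insert aQ' cQ; first by rewrite inE eq_sym.
  by case/negP: (ff a c); find_subseq.
by violate av [:: a; c; p].
Qed.

Lemma state_empty_Q a w Q : state [::] (a :: w) Q -> a \notin w -> a :: w = Q.
Proof.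
case=> _ uQ tw ff av _ aw; rewrite cat0s in tw ff.
have thr (c : nat) := not_thrice (all_twice_le2 c tw).
have aQ : a \in Q.
  have [//|] := @mem_other a [::] (w ++ Q) (tw a (mem_head _ _)).
  by rewrite mem_cat (negbTE aw).
have uw : uniq (a :: w).
  rewrite /= aw; apply: uniq_subseq2 => c; apply/negP => cw.
  by case/negP: (ff a c); find_subseq.
apply: fifo_eq => // c; have := tw c; rewrite mem_cat count_cat !count_uniq_mem //.
by case: (c \in a :: w); case: (c \in Q) => // /(_ isT).
Qed.

(** With an empty queue, the next block [X] is taken as long as possible: [a] and
    all letters that follow both occurrences of [a] alike.  Then the letters
    [w1] that enter between the two occurrences of [X] are separated from [X]
    by the maximality of [X]. *)
Lemma state_empty_block a w Q : state [::] (a :: w) Q -> a \in w ->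
  exists X w1 w2, [/\ X != [::], a :: w = X ++ w1 ++ X ++ w2 & state w1 w2 Q].
Proof.
move=> st aw; case/splitPr: aw => w1 w2 in st *.
have [z [w1' [w2' [? ? neq]]]] := common_prefix w1 w2; subst w1 w2.
exists (a :: z), w1', w2'; split=> //; first by repeat rewrite -?catA ?cat_cons.
case: st => _ uQ tw ff av _; rewrite cat0s in tw ff.
have thr (c : nat) := not_thrice (all_twice_le2 c tw).
have uX : uniq w1'.
  by apply: uniq_subseq2 => c; apply/negP => cw; case/negP: (ff a c); find_subseq.
have sub : subseq (w1' ++ w2' ++ Q) ((a :: (z ++ w1') ++ a :: z ++ w2') ++ Q).
  repeat rewrite -?catA ?cat_cons; apply/subseq_skip/subseq_skipcat/cat_subseq => //.
  by apply/subseq_skip/subseq_skipcat.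
have ff' : fifo (w1' ++ w2' ++ Q) by apply: fifo_sub ff.
have tw' : all_twice (w1' ++ w2' ++ Q).
  move=> c cT; have := tw c (mem_subseq sub cT).
  rewrite !(count_cat, cat_cons) /= !(count_cat, cat_cons) /= !count_cat.
  have -> : count_mem c z = 0.
    apply/count_memPn/negP => aP; case/negP: (thr c).
    by move: cT; rewrite !mem_cat => /or3P[cX|cw|cQ]; find_subseq.
  have -> : (a == c) = false.
    apply/eqP => ac; case/negP: (thr c); rewrite ac.
    by move: cT; rewrite !mem_cat => /or3P[cX|cw|cQ]; find_subseq.
  by lia.
(* the letter [s] after the second [X] enters there, for otherwise it would be
   the first letter of [w1'], against the maximality of [X] *)
have closed s w2 : w1' != [::] -> w2' = s :: w2 ->
    s \notin w1' /\ (s \in w2 \/ s \in Q).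
  move=> w10 w2E; rewrite w2E in tw' neq tw ff av thr *.
  have sw1 : s \notin w1'.
    case: w1' => // b w1 in w10 uX sub ff' tw' neq tw ff av thr *.
    have bs : b != s by apply: neq.
    rewrite inE eq_sym (negbTE bs) /=; apply/negP => sw1.
    case: (@mem_other b [::] (w1 ++ (s :: w2) ++ Q)) => //.
      by apply: tw'; rewrite !(mem_cat, inE) eqxx.
    rewrite !(mem_cat, inE) => /or3P[bw|/orP[/eqP bs'|bw]|bQ].
    - by move: uX; rewrite /= bw.
    - by rewrite bs' eqxx in bs.
    - by case/negP: (ff b s); find_subseq.
    - by case/negP: (ff b s); find_subseq.
  split=> //; case: (@mem_other s w1' (w2 ++ Q)).
  - by apply: tw'; rewrite !(mem_cat, inE) eqxx !orbT.
  - by rewrite (negbTE sw1).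
  - by rewrite mem_cat => /orP.
(* [s] separates [a] from [w1'], so the letters of [w1'] stay together *)
have block x y c : subseq [:: x; y] w1' -> subseq [:: x; c; y] w2' ->
    subseq [:: x; c; y; c] w2' \/ c \in Q -> False.
  move=> xy xcy.
  have yw : y \in w1' by apply: (mem_subseq xy); rewrite !inE eqxx orbT.
  have w10 : w1' != [::] by apply: contraTneq yw => ->.
  case w2E: w2' xcy => [//|s w2] xcy; have [sw1 sw2] := closed _ _ w10 w2E.
  rewrite w2E in tw ff av thr.
  have xs : x != s.
    by apply: contraNneq sw1 => <-; apply: (mem_subseq xy); rewrite mem_head.
  have ys : y != s by apply: contraNneq sw1 => <-.
  rewrite /= (negbTE xs) in xcy; case=> [|cQ].
    rewrite /= (negbTE xs) => xcyc.
    have cc : subseq [:: c; c] w2 by apply: subseq_trans xcyc; find_subseq.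
    have cs : c != s.
      by apply/eqP => cs; case/negP: (thr s); rewrite cs in cc; find_subseq.
    case: sw2 => [sw2|sQ]; last by case/negP: (ff s c); find_subseq.
    have [|i _] := subseq_insert xcyc sw2.
      by rewrite !inE !negb_or !(eq_sym s) xs ys cs.
    case: i => [|[|[|[|i]]]] /= si.
    - by case/negP: (ff y s); find_subseq.
    - by case/negP: (ff y s); find_subseq.
    - by case/negP: (ff y s); find_subseq.
    - by violate av [:: a; x; y; s; c].
    - by case/negP: (ff s c); find_subseq.
  have cw : c \in w2 by apply: (mem_subseq xcy); rewrite !inE eqxx orbT.
  have cs : c != s.
    by apply/eqP => cs; case/negP: (thr s); rewrite cs in cw cQ; find_subseq.
  case: sw2 => [sw2|sQ].
    have [|i _] := subseq_insert xcy sw2.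
      by rewrite !inE !negb_or !(eq_sym s) xs ys cs.
    case: i => [|[|[|i]]] /= si.
    - by case/negP: (ff y s); find_subseq.
    - by case/negP: (ff y s); find_subseq.
    - by case/negP: (ff y s); find_subseq.
    - by violate av [:: c; s; y; a].
  have sQ' : subseq [:: s] Q by rewrite sub1seq.
  have [|[|i] _ /= csQ] := subseq_insert sQ' cQ; first by rewrite inE.
    by case/negP: (ff s c); find_subseq.
  by violate av [:: s; c; x].
split=> //.
{ move=> g f; rewrite !inE; repeat (case/orP=> [/eqP->|]); last move/eqP->.
  all: move=> s1 s2 s3; cbv [map fst snd] in s1, s2, s3.
  all: try by violate av [:: f 0; f 1; f 2; f 3; f 4].
  all: try by violate av [:: a; f 0; f 1; f 2; f 3; f 4].
  all: try by violate av [:: f 1; f 2; f 0; a; f 3].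
  all: try by violate av [:: f 3; f 2; f 1; f 0].
  - apply: (block (f 0) (f 1) (f 2)) => //; last by left.
    by apply: subseq_trans s2; find_subseq.
  - by apply: (block (f 0) (f 1) (f 2)) => //; right; rewrite -sub1seq.
  - by violate av [:: f 2; f 1; f 0; a]. }
case: w2' => // s w2 in sub ff' tw' neq tw ff av thr closed block * => _ c cw1.
have [|sw1 sw2] := closed s w2 _ erefl; first by apply: contraTneq cw1 => ->.
apply: contraT => cw2; exfalso.
have cQ : c \in Q.
  have := tw' c; rewrite !(mem_cat, count_cat) (count_uniq_mem c uX) cw1.
  by move=> /(_ isT); rewrite (count_memPn cw2) count_uniq_mem //; case: (c \in Q).
case: sw2 => [sw2|sQ]; first by case/negP: (ff c s); find_subseq.
have cQ' : subseq [:: c] Q by rewrite sub1seq.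
have [|[|i] _ /= csQ] := subseq_insert cQ' sQ.
- by rewrite inE; apply: contraNneq sw1 => ->.
- by case/negP: (ff c s); find_subseq.
by violate av [:: c; s; a].
Qed.

(** The blocks are split off one by one; the letters that enter before a block
    has left form the next block, and an empty block is inserted whenever the
    queue becomes empty. *)
Lemma state_chain P w Q : state P w Q -> chain P w Q.
Proof.
have [n] := ubnP (size w); elim: n => // n IH in P w Q * => wn st.
have [w0|w0] := eqVneq w [::].
  by rewrite w0 in st *; rewrite (state_nil st); constructor.
case: P => [|p P] in st *; last first.
  have [X [w' wE]] := state_split st w0; rewrite wE in st wn *.
  constructor; apply: IH; last by apply: (@state_step p) st; rewrite mem_head.
  by move: wn; rewrite !size_cat /=; lia.
case: w w0 => // a w _ in wn st *.
have [aw|aw] := boolP (a \in w); last first.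
  rewrite (state_empty_Q st aw) -[X in chain _ X _]cats0.
  exact/(@chain_step [::])/chain_nil.
have [X [w1 [w2 [X0 wE st']]]] := state_empty_block st aw.
rewrite wE in wn *; apply: (@chain_step [::]); constructor; apply: IH => //.
by move: wn; rewrite !size_cat; case: X X0 {wE} => //= *; lia.
Qed.

(** * Stripping common prefixes and suffixes *)

(** In A xy B xy C, the letters of [P] are those common to A and B, and the
    letters of [Q] those common to B and C. *)
Record tight (P B Q : word) : Prop := Tight {
  tight_subP : {subset P <= B};
  tight_subQ : {subset Q <= B};
  tight_twice : all_twice (P ++ B ++ Q);
  tight_avoid : avoid obstructions P B Q }.

Lemma mirror_obstruction g : g \in obstructions -> mirror g \in obstructions.
Proof. by move: g; apply/allP. Qed.

Lemma avoid_mirror A B C :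
  avoid obstructions A B C -> avoid obstructions (rev C) (rev B) (rev A).
Proof.
move=> av g f gF s1 s2 s3; apply: (av _ f (mirror_obstruction gF)) => /=.
- by rewrite map_rev -subseq_rev revK.
- by rewrite map_rev -subseq_rev revK.
- by rewrite map_rev -subseq_rev revK.
Qed.

Lemma tight_rev P B Q : tight P B Q -> tight (rev Q) (rev B) (rev P).
Proof.
case=> sP sQ tw av; split; last exact: avoid_mirror.
- by move=> a; rewrite !mem_rev; apply: sQ.
- by move=> a; rewrite !mem_rev; apply: sP.
move=> a; rewrite -!rev_cat -catA mem_rev count_rev; exact: tw.
Qed.

(** After the common suffix Z1 has been removed. *)
Definition stripped (P B : word) :=
  forall P' B' a, P = rcons P' a -> B <> rcons B' a.

Lemma tight_not_thrice P B Q a :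
  tight P B Q -> ~~ subseq [:: a; a; a] (P ++ B ++ Q).
Proof. by move=> tg; apply/not_thrice/all_twice_le2/tight_twice. Qed.

(** The last letter [r] of [B] witnesses that [B] goes on after the letters of
    [P]; adding it completes some queue obstructions to words of V. *)
Lemma tight_last P B Q a : tight P B Q -> stripped P B -> a \in P ->
  exists B0 r, [/\ B = rcons B0 r, r \notin P, a \in B0 & r \in B0 \/ r \in Q].
Proof.
move=> tg st aP; have [sP _ tw av] := tg; have thr c := tight_not_thrice c tg.
have [P0 [l PE]] : exists P0 l, P = rcons P0 l.
  by clear -aP; case/lastP: P aP => // P0 l; exists P0, l.
have [B0 [r BE]] : exists B0 r, B = rcons B0 r.
  by have := sP a aP; clear; case/lastP: B => // B0 r; exists B0, r.
have lr : l != r by apply/eqP => lr; apply: (st P0 B0 l PE); rewrite BE lr.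
have lP : l \in P by rewrite PE mem_rcons mem_head.
have lB : l \in B0 by move: (sP l lP); rewrite BE mem_rcons inE (negbTE lr).
have rP : r \notin P.
  rewrite PE mem_rcons inE eq_sym (negbTE lr) /=; apply/negP => rP.
  by rewrite PE BE -!cats1 in av; violate av [:: r; l].
exists B0, r; split=> //.
  move: (sP a aP); rewrite BE mem_rcons inE => /orP[/eqP ar|//].
  by rewrite -ar aP in rP.
case: (@mem_other r (P ++ B0) Q).
- have := tw r; rewrite BE !mem_cat mem_rcons mem_head orbT => /(_ isT).
  by rewrite -cats1 -!catA.
- by rewrite mem_cat (negbTE rP); left.
by right.
Qed.

Lemma tight_disjoint P B Q a : tight P B Q -> a \in P -> a \in Q -> False.
Proof.
move=> tg aP aQ; case/negP: (tight_not_thrice a tg); have aB := tight_subP tg aP.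
by find_subseq.
Qed.

Lemma tight_uniq P B Q : tight P B Q -> uniq P.
Proof.
move=> tg; apply: uniq_subseq2 => a; apply/negP => aa.
have aB : a \in B.
  by apply: (tight_subP tg); apply: (mem_subseq aa); rewrite mem_head.
by case/negP: (tight_not_thrice a tg); find_subseq.
Qed.

(** A letter [b] occurring twice before [a] would be nested in [a].  The five
    positions of the other occurrence of [r] give words of V. *)
Lemma tight_nest P B Q a b :
  tight P B Q -> stripped P B -> a \in P -> ~~ subseq [:: b; b; a] B.
Proof.
move=> tg st aP; apply/negP => bba.
have [B0 [r [BE rP aB0 rBQ]]] := tight_last tg st aP.
have ar : a != r by apply: contraNneq rP => <-.
have thr c := tight_not_thrice c tg.
have [_ _ _ av] := tg.
have {}bba : subseq [:: b; b; a] B0.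
  by move: bba; rewrite BE -(@subseq_rcons_neq [:: b; b] B0 a r ar).
have bb : subseq [:: b; b] B0 by apply: subseq_trans bba; find_subseq.
have rb : r != b.
  by apply/eqP => rb; case/negP: (thr b); rewrite BE -cats1 rb; find_subseq.
rewrite BE -cats1 in av; case: rBQ => [rB0|rQ]; last by violate av [:: a; b; r].
have [|i _] := subseq_insert bba rB0.
  by rewrite !inE !negb_or rb eq_sym ar.
case: i => [|[|[|i]]] /= si.
- by violate av [:: r; b].
- by violate av [:: a; b; r].
- by violate av [:: a; b; r].
- by violate av [:: a; b; r].
Qed.

(** This queue obstruction is not itself a word of V: without the letter [r] the
    second letter could belong to Z1. *)
Lemma tight_gap P B Q a b c : tight P B Q -> stripped P B ->
  subseq [:: a; b] P -> subseq [:: a; c; b] B -> c \in Q -> False.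
Proof.
move=> tg st ab acb cQ.
have bP : b \in P by apply: (mem_subseq ab); rewrite !inE eqxx orbT.
have aP : a \in P by apply: (mem_subseq ab); rewrite mem_head.
have [B0 [r [BE rP bB0 rBQ]]] := tight_last tg st bP.
have ar : a != r by apply: contraNneq rP => <-.
have br : b != r by apply: contraNneq rP => <-.
have thr d := tight_not_thrice d tg.
have [_ _ _ av] := tg.
have {}acb : subseq [:: a; c; b] B0.
  by move: acb; rewrite BE -(@subseq_rcons_neq [:: a; c] B0 b r br).
have cB0 : c \in B0 by apply: (mem_subseq acb); rewrite !inE eqxx orbT.
have rc : r != c.
  by apply/eqP => rc; case/negP: (thr c); rewrite BE -cats1 rc; find_subseq.
rewrite BE -cats1 in av; case: rBQ => [rB0|rQ].
  have [|i _] := subseq_insert acb rB0.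
    by rewrite !inE !negb_or rc (eq_sym r a) (eq_sym r b) ar br.
  case: i => [|[|[|i]]] /= si.
  - by violate av [:: b; r; c].
  - by violate av [:: a; b; r].
  - by violate av [:: a; b; r].
  - by violate av [:: a; b; c; r].
have cQ' : subseq [:: c] Q by rewrite sub1seq.
have [|[|i] _ /= crQ] := subseq_insert cQ' rQ; first by rewrite inE.
  by violate av [:: c; r].
by violate av [:: a; b; c; r].
Qed.

(** The obstructions on the right-hand boundary follow from those on the left,
    as V is closed under reversal. *)
Lemma tight_state P B Q : tight P B Q -> stripped P B -> stripped (rev Q) (rev B) ->
  state P B Q.
Proof.
move=> tg stP stQ; have [sP sQ tw av] := tg.
have tg' := tight_rev tg.
split=> //; first exact: tight_uniq tg.
- by rewrite -rev_uniq; apply: tight_uniq tg'.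
- have disj c := @tight_disjoint _ _ _ c tg.
  have uP := tight_uniq tg; have := tight_uniq tg'; rewrite rev_uniq => uQ.
  move=> a b; apply/negP => /subseq_catP[i _ [s1 /subseq_catP[j _ [s2 s3]]]].
  have nodup (c : nat) (s t : word) :
      uniq s -> subseq t s -> subseq [:: c; c] t -> False.
    move=> us ts /subseq_trans/(_ ts)/subseq_uniq/(_ us).
    by rewrite /= inE eqxx.
  case: i s1 s2 s3 => [|[|[|i]]] /= s1.
  - case: j => [|[|[|[|j]]]] /= s2 s3.
    + by apply: (nodup b _ _ uQ s3); find_subseq.
    + by apply: (nodup b _ _ uQ s3); find_subseq.
    + by violate av [:: a; b].
    + have := @tight_nest _ _ _ a b tg' stQ; rewrite mem_rev -sub1seq s3.
      by move=> /(_ isT)/negP; apply; rewrite -subseq_rev revK.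
    + by violate av [:: a; b].
  - rewrite sub1seq in s1; case: j => [|[|[|j]]] /= s2 s3.
    + by apply: (nodup b _ _ uQ s3); find_subseq.
    + by apply: (disj a s1); apply: (mem_subseq s3); rewrite !inE eqxx orbT.
    + by apply: (disj a s1); rewrite -sub1seq.
    + by case/negP: (tight_nest b tg stP s1).
  - have aP : a \in P by apply: (mem_subseq s1); rewrite mem_head.
    case: j => [|[|j]] /= s2 s3.
    + by apply: (disj a aP); apply: (mem_subseq s3); rewrite !inE eqxx orbT.
    + by apply: (disj a aP); rewrite -sub1seq.
    + by violate av [:: a; b].
  - by move=> _ _; apply: (nodup b _ _ uP s1); find_subseq.
move=> g f; rewrite !inE; repeat (case/orP=> [/eqP->|]); last move/eqP->.
all: move=> s1 s2 s3; cbv [map fst snd] in s1, s2, s3.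
all: try by violate av [:: f 0; f 1; f 2; f 3; f 4].
all: try by violate av [:: f 3; f 2; f 1; f 0].
all: try by violate av [:: f 4; f 3; f 2; f 1; f 0].
all: try by violate av [:: f 3; f 1; f 2; f 0].
all: try by violate av [:: f 1; f 0; f 2].
- by apply: (@tight_gap _ _ _ (f 0) (f 1) (f 2) tg stP); rewrite // -sub1seq.
- apply: (@tight_gap _ _ _ (f 1) (f 0) (f 2) tg' stQ);
    rewrite ?mem_rev -?sub1seq //.
    by rewrite -subseq_rev revK.
  by rewrite -subseq_rev revK.
- by violate av [:: f 0; f 2; f 1; f 4; f 3].
Qed.

Lemma stripped_or (P B : word) :
  stripped P B \/ exists P' B' a, P = rcons P' a /\ B = rcons B' a.
Proof.
case/lastP: P => [|P a]; first by left=> -[].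
case/lastP: B => [|B b]; first by left=> ? [].
have [->|ab] := eqVneq a b; first by right; exists P, B, b.
by left=> P' B' c /rcons_inj[_ ac] /rcons_inj[_ bc]; rewrite ac bc eqxx in ab.
Qed.

Lemma tight_rcons P B Q a : tight (rcons P a) (rcons B a) Q -> tight P B Q.
Proof.
move=> tg; have [sP sQ tw av] := tg.
have aQ : a \notin Q.
  by apply/negP; apply: (tight_disjoint tg); rewrite mem_rcons mem_head.
have := tight_uniq tg; rewrite rcons_uniq => /andP[aP _].
have cnt (c : nat) : count_mem c (rcons P a ++ rcons B a ++ Q) =
    (a == c).*2 + count_mem c (P ++ B ++ Q).
  by rewrite -!cats1 !count_cat /=; lia.
split.
- move=> c cP; have := sP c; rewrite !mem_rcons !inE cP orbT => /(_ isT).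
  by case: eqP cP aP => // -> ->.
- move=> c cQ; have := sQ c cQ; rewrite mem_rcons inE.
  by case: eqP cQ aQ => // -> ->.
- move=> c cT; have := tw c; rewrite cnt !mem_cat !mem_rcons !inE => h.
  have {h} := h _; move: cT; rewrite !mem_cat => /or3P cT.
  have -> : (a == c) = false.
    apply/eqP => ac; have := tw a; rewrite cnt eqxx mem_cat mem_rcons mem_head.
    move=> /(_ isT) /eqP; rewrite -[2]addn0 eqn_add2l -leqn0 leqNgt -has_count.
    by rewrite has_pred1 !mem_cat ac; case: cT => ->; rewrite ?orbT.
  by apply; case: cT => ->; rewrite ?orbT.
move=> g f gF s1 s2 s3; apply: (av g f gF) => //.
- exact: subseq_trans s1 (subseq_rcons _ _).
- exact: subseq_trans s2 (subseq_rcons _ _).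
Qed.

(** Common last letters of [P] and [B] go into [Z1], common first letters of [B]
    and [Q] into [Z2], and what remains is a queue. *)
Lemma tight_decomposition P B Q : tight P B Q ->
  exists X0 Z1 Z2 mid Xn, [/\ P = X0 ++ Z1, B = Z2 ++ mid ++ Z1, Q = Z2 ++ Xn,
    chain X0 mid Xn & mid = [::] -> X0 = [::]].
Proof.
have [n] := ubnP (size B); elim: n => // n IH in P B Q * => Bn tg.
have [stP|[P' [B' [a [PE BE]]]]] := stripped_or P B; last first.
  subst P B; rewrite size_rcons in Bn.
  have [X0 [Z1 [Z2 [mid [Xn [-> -> -> ch m0]]]]]] := IH _ _ _ Bn (tight_rcons tg).
  by exists X0, (rcons Z1 a), Z2, mid, Xn; rewrite -?rcons_cat.
have [stQ|[Q' [B' [a [QE BE]]]]] := stripped_or (rev Q) (rev B); last first.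
  have tg' := tight_rev tg; rewrite QE BE in tg'.
  have := tight_rev (tight_rcons tg'); rewrite revK => {}tg'.
  rewrite -(revK B) -(revK Q) QE BE !rev_rcons in Bn *.
  have [X0 [Z1 [Z2 [mid [Xn [-> -> -> ch m0]]]]]] := IH _ _ _ Bn tg'.
  by exists X0, Z1, (a :: Z2), mid, Xn.
exists P, [::], [::], B, Q; split=> //; rewrite ?cats0 //.
  exact/state_chain/tight_state.
move=> BE; have := tight_subP tg; rewrite BE.
by case: (P) => // p ? /(_ p (mem_head _ _)).
Qed.

(** * The context of two equal factors xy *)

(** What V forces on A, B, C when x and y may be exchanged in A xy B xy C: the
    middle three conditions express the words xyaxy and atxyaxy, with their
    reversals, where the letter t occurs once. *)
Record critical (A B C : word) : Prop := Critical {
  critical_le2 : forall a, count_mem a (A ++ B ++ C) <= 2;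
  critical_mid : forall a, a \in B -> count_mem a (A ++ B ++ C) = 2;
  critical_left : forall a t, a \in B -> count_mem t (A ++ B ++ C) = 1 ->
    ~~ subseq [:: a; t] A;
  critical_right : forall a t, a \in B -> count_mem t (A ++ B ++ C) = 1 ->
    ~~ subseq [:: t; a] C;
  critical_avoid : avoid obstructions A B C }.

Lemma critical_rev A B C : critical A B C -> critical (rev C) (rev B) (rev A).
Proof.
have cnt a : count_mem a (rev C ++ rev B ++ rev A) = count_mem a (A ++ B ++ C).
  by rewrite !count_cat !count_rev; lia.
case=> le2 mid left right av; split; last exact: avoid_mirror.
- by move=> a; rewrite cnt.
- by move=> a; rewrite cnt mem_rev; apply: mid.
- move=> a t; rewrite cnt mem_rev => aB t1.
  by rewrite -subseq_rev revK; apply: right.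
- move=> a t; rewrite cnt mem_rev => aB t1.
  by rewrite -subseq_rev revK; apply: left.
Qed.

(** From the leftmost letter [a] common to A and B onwards, every letter [b] of A
    must occur in B, for otherwise [a] and [b] form an obstruction wherever the
    other occurrence of [b] is. *)
Lemma critical_suffix A B C : critical A B C ->
  exists A' P, [/\ A = A' ++ P, {subset P <= B} & forall a, a \in B -> a \notin A'].
Proof.
case=> le2 mid left right av.
have [hasB|hasB] := boolP (has (mem B) A); last first.
  exists A, [::]; split=> [||a aB]; rewrite ?cats0 //.
  by apply: contra hasB => aA; apply/hasP; exists a.
case/split_find: hasB mid left av le2 => a A' P aB A'B mid left av le2.
have {}aB : a \in B by [].
exists A', (a :: P); split; first by rewrite cat_rcons.
  have thr b := not_thrice (le2 b).
  move=> b; rewrite inE => /predU1P[->//|bP].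
  rewrite cat_rcons in av left mid le2 thr.
  have ab : a != b.
    by apply: contraTneq bP => <-; apply/negP=> aP; case/negP: (thr a); find_subseq.
  case c2: (count_mem b ((A' ++ a :: P) ++ B ++ C) == 1).
    by case/negP: (left _ _ aB (eqP c2)); find_subseq.
  have [P1 [P2 PE]] : exists P1 P2, P = P1 ++ b :: P2.
    by case/splitPr: bP => P1 P2; exists P1, P2.
  subst P.
  have {}c2 : count_mem b ((A' ++ a :: P1) ++ b :: P2 ++ B ++ C) = 2.
    move: c2 (le2 b).
    by rewrite !(count_cat, cat_cons) /= !(count_cat, cat_cons) /= eqxx; lia.
  case/mem_other: c2; rewrite !(mem_cat, inE).
    case/or3P=> [bA'|/eqP ba|bP1].
    - by exfalso; violate av [:: b; a].
    - by rewrite ba eqxx in ab.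
    - by exfalso; violate av [:: a; b].
  case/or3P=> [bP2|//|bC].
  - by exfalso; violate av [:: a; b].
  - by exfalso; violate av [:: a; b].
move=> b bB; apply: contra A'B => bA'; apply/hasP; by exists b.
Qed.

Lemma critical_tight A B C : critical A B C ->
  exists A' P Q C', [/\ A = A' ++ P, C = Q ++ C' & tight P B Q].
Proof.
move=> cr; have [A' [P [AE PB A'B]]] := critical_suffix cr.
have [C' [Q [CE QB C'B]]] := critical_suffix (critical_rev cr).
exists A', P, (rev Q), (rev C').
have {}CE : C = rev Q ++ rev C' by rewrite -rev_cat -CE revK.
split=> //; have [le2 mid left right av] := cr; split=> //.
- by move=> a; rewrite mem_rev => /QB; rewrite mem_rev.
- move=> a aT.
  have aB : a \in B.
    move: aT; rewrite !mem_cat mem_rev => /or3P[/PB|//|/QB] //.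
    by rewrite mem_rev.
  rewrite -(mid a aB) AE CE !count_cat (count_memPn (A'B a aB)).
  have := C'B a; rewrite mem_rev aB -mem_rev => /(_ isT)/count_memPn ->.
  by lia.
- move=> g f gF s1 s2 s3; apply: (av g f gF) => //.
    by rewrite AE; apply: subseq_trans s1 (suffix_subseq _ _).
  by rewrite CE; apply: subseq_trans s3 (prefix_subseq _ _).
Qed.

(** * Consequences of Sigma *)

Definition subst (phi : nat -> word) (u : word) : word := flatten (map phi u).

Lemma subst_cat phi u v : subst phi (u ++ v) = subst phi u ++ subst phi v.
Proof. by rewrite /subst map_cat flatten_cat. Qed.

Definition eqv (u v : word) := consequence Sigma (u, v).

Lemma eval_cat (M : Type) (one : M) (mul : Monoid.law one) theta u v :
  eval mul theta (u ++ v) = mul (eval mul theta u) (eval mul theta v).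
Proof. exact: big_cat. Qed.

Lemma eval_subst (M : Type) (one : M) (mul : Monoid.law one) theta phi u :
  eval mul theta (subst phi u) = eval mul (fun i => eval mul theta (phi i)) u.
Proof.
elim: u => [|a u IH]; first by rewrite /eval !big_nil.
rewrite -[subst phi _]/(phi a ++ subst phi u) eval_cat IH.
by rewrite /eval big_cons.
Qed.

Lemma eqv_refl u : eqv u u.
Proof. by []. Qed.

Lemma eqv_sym u v : eqv u v -> eqv v u.
Proof. by move=> uv M one mul h theta; rewrite (uv M one mul h theta). Qed.

Lemma eqv_trans v u w : eqv u v -> eqv v w -> eqv u w.
Proof.
move=> uv vw M one mul h theta.
by rewrite (uv M one mul h theta) (vw M one mul h theta).
Qed.

Lemma eqv_cat u u' v v' : eqv u u' -> eqv v v' -> eqv (u ++ v) (u' ++ v').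
Proof.
move=> uu vv M one mul h theta.
by rewrite !eval_cat (uu M one mul h theta) (vv M one mul h theta).
Qed.

Lemma eqv_instance phi e : Sigma e -> eqv (subst phi e.1) (subst phi e.2).
Proof. by move=> Se M one mul h theta; rewrite !eval_subst; apply: h. Qed.

Lemma chain_words P m Q : chain P m Q ->
  exists n (X : nat -> word), [/\ X 0 = P, X n = Q &
    m = flatten [seq X i ++ X i.-1 | i <- iota 1 n]].
Proof.
elim=> [R|R X1 w R' _ [n [X [X0 Xn ->]]]]; first by exists 0, (fun=> R).
exists n.+1, (fun i => if i is j.+1 then X j else R); split=> //=.
rewrite X0 -catA; congr (_ ++ (_ ++ _)).
rewrite -[2]addn1 iotaDl -map_comp; congr flatten; apply/eq_in_map => i.
by rewrite mem_iota; case: i.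
Qed.

Lemma iota_chain (X : nat -> word) m n :
  chain (X m) (flatten [seq X i ++ X i.-1 | i <- iota m.+1 n]) (X (m + n)).
Proof.
elim: n m => [|n IH] m /=; first by rewrite addn0; constructor.
by rewrite -catA; constructor; rewrite addnS -addSn.
Qed.

Lemma subst_w_pattern phi p q n :
  subst phi (w_pattern p q n) =
  phi 6 ++ phi 2 ++ (phi p ++ phi q) ++ phi 3 ++
  flatten [seq phi (6 + i) ++ phi (6 + i.-1) | i <- iota 1 n] ++
  phi 2 ++ (phi p ++ phi q) ++ phi 3 ++ phi (6 + n).
Proof.
rewrite /w_pattern !subst_cat /= /subst /= !cats0 -!catA.
do 5! congr (_ ++ _); congr (_ ++ _).
elim: (iota 1 n) => //= i s IH; rewrite -!catA; by do 2! congr (_ ++ _).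
Qed.

(** This is w_n with Z1, Z2 for z1, z2.  For n = 1 the middle X1 X0 is absorbed
    by taking X0 Z1 for z1 and Z2 X1 for z2, and all x_i empty. *)
Lemma eqv_chain x y P m Q Z1 Z2 : chain P m Q -> (m = [::] -> P = [::]) ->
  eqv (P ++ Z1 ++ [:: x; y] ++ Z2 ++ m ++ Z1 ++ [:: x; y] ++ Z2 ++ Q)
      (P ++ Z1 ++ [:: y; x] ++ Z2 ++ m ++ Z1 ++ [:: y; x] ++ Z2 ++ Q).
Proof.
move=> /chain_words[n [X [<- <- ->]]] m0 {P m Q}.
(* the letters 0, 1, 2, 3 and 6 + i are x, y, z1, z2 and x_i *)
pose phi Y1 Y2 (Y : nat -> word) k : word :=
  match k with 0 => [:: x] | 1 => [:: y] | 2 => Y1 | 3 => Y2 | _ => Y (k - 6) end.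
have swap Y1 Y2 Y n2 : 2 <= n2 ->
  eqv (subst (phi Y1 Y2 Y) (w_ n2)) (subst (phi Y1 Y2 Y) (w'_ n2)).
  by move=> n2_ge2; apply: (eqv_instance _ (Sigma_w n2_ge2)).
have expand Y1 Y2 Y p q n2 : p <= 1 -> q <= 1 ->
  subst (phi Y1 Y2 Y) (w_pattern p q n2) =
  Y 0 ++ Y1 ++ (phi Y1 Y2 Y p ++ phi Y1 Y2 Y q) ++ Y2 ++
  flatten [seq Y i ++ Y i.-1 | i <- iota 1 n2] ++
  Y1 ++ (phi Y1 Y2 Y p ++ phi Y1 Y2 Y q) ++ Y2 ++ Y n2.
  move=> _ _; rewrite subst_w_pattern /= subnn addKn; do 4! congr (_ ++ _).
  by congr (flatten _ ++ _); apply: eq_map => i /=; rewrite !addKn.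
case: n => [|[|n]] in m0 *.
- have {swap} := swap Z1 Z2 (fun=> [::]) 2 isT.
  by rewrite !expand // (m0 erefl) /= !cats0.
- have {swap} := swap (X 0 ++ Z1) (Z2 ++ X 1) (fun=> [::]) 2 isT.
  by rewrite !expand //= !cats0 -!catA.
by have {swap} := swap Z1 Z2 X n.+2 isT; rewrite !expand.
Qed.

(** * Evaluation in the Rees quotient *)

Lemma rees_mul_insub W (p q : word) :
  rees_mul (insub p : rees W) (insub q) = insub (p ++ q).
Proof.
have [hp|np] := boolP (subword W p); last first.
  rewrite (insubN _ np) [RHS]insubN //; apply: contra np.
  exact: (@subword_infix W [::]).
have [hq|nq] := boolP (subword W q); first by rewrite (insubT _ hp) (insubT _ hq).
rewrite (insubN _ nq) [RHS]insubN; first by case: insub.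
by apply: contra nq => hpq; apply: (@subword_infix W p _ [::]); rewrite cats0.
Qed.

Lemma eval_insub W (phi : nat -> word) u :
  eval (rees_monoid W) (fun i => insub (phi i)) u = insub (subst phi u).
Proof.
elim: u => [|a u IH].
  by rewrite /eval big_nil; apply/esym; apply: insubT.
by rewrite /eval big_cons -/(eval _ _ _) IH; apply: rees_mul_insub.
Qed.

Lemma insub_word W (p : rees W) w : ~~ subword W w ->
  insub (if p is Some p' then val p' else w) = p.
Proof. by case: p => [p|] nw; [rewrite valK | rewrite insubN]. Qed.

(** Every element of M(V) is the image of a word, the zero being the image of any
    word that is not a factor of a word of V. *)
Lemma satisfies_reesP u v : satisfies (rees_monoid V) (u, v) <->
  forall phi, subword V (subst phi u) || subword V (subst phi v) ->
    subst phi u = subst phi v.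
Proof.
split=> [sat phi | sat theta].
  have := sat (fun i => insub (phi i)); rewrite !eval_insub /=.
  case: insubP => [u' -> uE|/negbTE->]; case: insubP => [v' -> vE|/negbTE->] //.
  by move=> [uv] _; rewrite -uE -vE uv.
(* the letter 9 does not occur in V *)
pose phi i := if theta i is Some p then val p else [:: 9].
have eval_phi w : eval (rees_monoid V) theta w = insub (subst phi w).
  rewrite -eval_insub; apply: eq_bigr => i _; apply/esym/insub_word.
  by vm_compute.
rewrite !eval_phi /=; have := sat phi.
case: (boolP (subword V (subst phi u))) => [_ /(_ isT)->//|nu].
case: (boolP (subword V (subst phi v))) => [_ /(_ isT)->//|nv] _.
by rewrite !insubN.
Qed.

(** * Isoterms *)

(** Replacing each letter by the position of its first occurrence gives the same
    word for two words exactly when they differ by a renaming of letters. *)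
Definition canon (s : word) : word := [seq index a s | a <- s].

Definition V_pattern (p : word) : bool :=
  has (fun w => has (fun k => canon (take (size p) (drop k w)) == canon p)
                    (iota 0 (size w))) V.

Lemma subword_factor w k n : w \in V -> subword V (take n (drop k w)).
Proof.
move=> wV; apply/orP; right; apply/hasP; exists w => //; apply/infixP.
by exists (take k w), (drop n (drop k w)); rewrite !cat_take_drop.
Qed.

Lemma nth_canon (s : word) i :
  i < size s -> nth 0 (canon s) i = index (nth 0 s i) s.
Proof. exact: nth_map. Qed.

Lemma size_canon s : size (canon s) = size s.
Proof. exact: size_map. Qed.

Lemma V_pattern_factor s :
  V_pattern s -> exists2 q, subword V q & canon q = canon s.
Proof.
case/hasP=> w wV /hasP[k _ /eqP nE].
by exists (take (size s) (drop k w)); first exact: subword_factor.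
Qed.

Lemma canon_decode (s q : word) :
  canon q = canon s -> [seq nth 0 q (index a s) | a <- s] = q.
Proof.
move=> nE; have sz : size q = size s by rewrite -size_canon nE size_canon.
apply: (@eq_from_nth _ 0) => [|i]; rewrite size_map -?sz // => iq.
rewrite (nth_map 0) -?sz // -nth_canon -?sz // -nE nth_canon //.
by rewrite nth_index ?mem_nth.
Qed.

Lemma subst_filter phi (s : word) u : (forall a, a \notin s -> phi a = [::]) ->
  subst phi u = subst phi (filter (mem s) u).
Proof.
move=> phi0; elim: u => //= a u IH; rewrite -[LHS]/(phi a ++ subst phi u) IH.
by case: ifP => //= /negbT /phi0 ->.
Qed.

(** Map the letters of [s] to the corresponding letters of a factor [q] of V, and
    all other letters to the empty word: [u] becomes [q], hence so does [v], and
    the renaming can be undone. *)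
Lemma isoterm_restrict u v s : satisfies (rees_monoid V) (u, v) -> V_pattern s ->
  filter (mem s) u = s -> filter (mem s) v = s.
Proof.
move=> /satisfies_reesP sat /V_pattern_factor[q qV nE] uE.
pose phi a := if a \in s then [:: nth 0 q (index a s)] else [::].
have phi0 a : a \notin s -> phi a = [::] by rewrite /phi => /negbTE->.
have phiE t : subst phi t = [seq nth 0 q (index a s) | a <- filter (mem s) t].
  rewrite (subst_filter _ phi0); elim: t => //= a t IH.
  by case: ifP => //= aS; rewrite -IH /subst /= /phi aS.
have := sat phi; rewrite !phiE uE canon_decode // qV => /(_ isT) qE.
have sz : size q = size s by rewrite -size_canon nE size_canon.
have decode a : a \in s -> nth 0 s (index (nth 0 q (index a s)) q) = a.
  move=> aS; have ia : index a s < size s by rewrite index_mem.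
  by rewrite -nth_canon ?sz // nE nth_canon // !nth_index.
have := congr1 (map (fun b => nth 0 s (index b q))) qE.
rewrite canon_decode // => sE; rewrite [RHS]sE -map_comp -[LHS]map_id.
by apply/eq_in_map => a; rewrite mem_filter => /andP[aS _] /=; rewrite decode.
Qed.

Lemma filter_complete (s u : word) : subseq s u ->
  (forall a, a \in s -> count_mem a u <= count_mem a s) -> filter (mem s) u = s.
Proof.
move=> su le; have sf : subseq s (filter (mem s) u).
  by rewrite subseq_filter su andbT; apply/allP.
apply/esym/eqP; rewrite -(size_subseq_leqif sf); apply/eqP/perm_size/allP => a.
rewrite mem_cat mem_filter => /orP aS /=; have {}aS : a \in s.
  by case: aS => // /andP[].
rewrite eqn_leq leq_count_subseq //= (leq_trans _ (le a aS)) //.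
exact/leq_count_subseq/filter_subseq.
Qed.

Lemma canon_map (f : nat -> nat) p :
  {in p &, injective f} -> canon (map f p) = canon p.
Proof.
move=> inj; rewrite /canon -map_comp; apply/eq_in_map => a ap /=.
have idx t : {subset t <= p} -> index (f a) (map f t) = index a t.
  elim: t => //= b t IH sub; rewrite (inj_in_eq inj) //; last first.
    by rewrite sub ?mem_head.
  by rewrite IH // => c ct; rewrite sub // inE ct orbT.
exact: idx.
Qed.

(** If [u] contained a renamed factor of V, with all occurrences of its letters
    and with x and y among them, then x and y would have to be ordered in [v] as
    they are in [u]. *)
Lemma no_pattern u v x y p f : satisfies (rees_monoid V) (u, v) ->
  filter (mem [:: x; y]) u <> filter (mem [:: x; y]) v ->
  V_pattern p -> subseq (map f p) u ->
  (forall i, i \in p -> count_mem (f i) u <= count_mem i p) ->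
  x \in map f p -> y \in map f p -> False.
Proof.
move=> sat xy isop pu le xp yp; apply: xy.
have cnt_map i : i \in p -> count_mem (f i) (map f p) = count_mem i p.
  move=> ip; apply/eqP; rewrite eqn_leq.
  rewrite (leq_trans (leq_count_subseq (pred1 (f i)) pu)) ?le //=.
  by rewrite count_map; apply: sub_count => j /= /eqP->.
(* two letters of [p] with the same image would occur too often in [u] *)
have inj : {in p &, injective f}.
  move=> i j ip jp fij; apply/eqP; apply: contraT => ij.
  have := cnt_map i ip; rewrite count_map => cE.
  have : count_mem i p + count_mem j p <= count_mem i p.
    rewrite -[in X in _ <= X]cE -count_predUI.
    rewrite [X in _ + X](_ : _ = 0); last first.
      apply/eqP; rewrite -leqn0 leqNgt -has_count; apply/hasPn => k _ /=.
      by apply: contra ij => /andP[/eqP-> /eqP->].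
    by rewrite addn0; apply: sub_count => k /= /orP[]/eqP->; rewrite ?fij.
  rewrite -[X in _ <= X]addn0 leq_add2l leqn0 => /eqP/count_memPn.
  by rewrite jp.
have fs : filter (mem (map f p)) u = map f p.
  apply: filter_complete => // _ /mapP[i ip ->]; rewrite cnt_map //; exact: le.
have isos : V_pattern (map f p) by rewrite /V_pattern size_map canon_map.
have fv := isoterm_restrict sat isos fs.
have restrict w : filter (mem [:: x; y]) w =
    filter (mem [:: x; y]) (filter (mem (map f p)) w).
  rewrite -filter_predI; apply/eq_filter => a /=.
  by rewrite !inE; case: eqP => [->|_] /=; [|case: eqP => [->|//]].
by rewrite restrict fs [RHS]restrict fv.
Qed.

(** Up to exchanging the letters, all words in which each of two letters occurs
    at most twice are factors of V, except for xyxy. *)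
Lemma two_letter_words p :
  all (gtn 2) p -> count_mem 0 p <= 2 -> count_mem 1 p <= 2 ->
  ~~ V_pattern p -> p = [:: 0; 1; 0; 1] \/ p = [:: 1; 0; 1; 0].
Proof.
do 5?[case: p => [|[|[|//]] p]; first by vm_compute; auto].
all: by move=> _ le0 le1 _; move: le0 le1; vm_compute.
Qed.

Lemma two_letters u v b c : satisfies (rees_monoid V) (u, v) -> b != c ->
  b \in u -> c \in u -> count_mem b u <= 2 -> count_mem c u <= 2 ->
  filter (mem [:: b; c]) u <> filter (mem [:: b; c]) v ->
  filter (mem [:: b; c]) u = [:: b; c; b; c] \/
  filter (mem [:: b; c]) u = [:: c; b; c; b].
Proof.
move=> sat bc bu cu b2 c2 neq; set s := filter _ u.
pose p := map (index^~ [:: b; c]) s.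
have sE : s = map (nth 0 [:: b; c]) p.
  rewrite -map_comp -[LHS]map_id; apply/eq_in_map => a.
  by rewrite mem_filter => /andP[aS _] /=; rewrite nth_index.
have cnt i : i < 2 -> count_mem i p = count_mem (nth 0 [:: b; c] i) u.
  move=> i2; rewrite count_map count_filter; apply: eq_count => a /=.
  rewrite !inE !(eq_sym a); case: i i2 => [|[|//]] _ /=.
    by case: (b == a) => //; case: (c == a).
  have [<-|_] := eqVneq b a; last by case: (c == a).
  by rewrite [c == b]eq_sym (negbTE bc).
have [] := @two_letter_words p; rewrite ?cnt //.
- apply/allP => _ /mapP[a + ->]; rewrite mem_filter => /andP[aS _].
  by rewrite -[gtn _ _]/(index a [:: b; c] < size [:: b; c]) index_mem.
- apply/negP => isop; apply: neq.
  have normE : canon s = canon p.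
    rewrite sE canon_map // => i j /mapP[a + ->] /mapP[a' + ->].
    rewrite !mem_filter => /andP[aS _] /andP[aS' _].
    by rewrite !nth_index // => ->.
  have isos : V_pattern s.
    have -> : V_pattern s = V_pattern p by rewrite /V_pattern -normE /p size_map.
    exact: isop.
  have memE : mem s =1 mem [:: b; c].
    move=> a /=; rewrite mem_filter /= !inE.
    have [->|_] := eqVneq a b; first by rewrite bu.
    by have [->|//] := eqVneq a c; rewrite cu.
  have us : filter (mem s) u = s by apply: eq_filter.
  by rewrite -(eq_filter memE v) (isoterm_restrict sat isos us).
- by move=> pE; left; rewrite sE pE.
- by move=> pE; right; rewrite sE pE.
Qed.

(** * Soundness *)

(** Skipping the steps where both the block entering and the block leaving are
    empty makes the number [n] of steps bounded by the length of [w]. *)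
Fixpoint chainb (n : nat) (P w Q : word) : bool :=
  (w == [::]) && (P == Q) ||
  if n is n'.+1 then
    has (fun i => if ((0 < i) || (P != [::])) && (take (size P) (drop i w) == P)
                  then chainb n' (take i w) (drop (i + size P) w) Q else false)
        (iota 0 (size w).+1)
  else false.

Lemma chain_chainb P w Q n : chain P w Q -> size w <= n -> chainb n P w Q.
Proof.
move=> ch; elim: ch n => [R|R X w' R' ch IH] n.
  by case: n => /= *; rewrite eqxx.
case: (altP (X ++ R =P [::])) => [|XR].
  by case: X ch IH => //; case: R => //= ch IH _; apply: IH.
rewrite !size_cat => szn; case: n szn => [|n] szn.
  by case: X XR {ch IH} szn => //; case: R.
apply/orP; right; apply/hasP; exists (size X).
  by rewrite mem_iota /= add0n ltnS !size_cat leq_addr.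
rewrite drop_size_cat // take_size_cat // eqxx take_size_cat //.
rewrite catA -size_cat drop_size_cat // ifT; last first.
  by case: X XR {ch IH szn} => //; case: R.
apply: IH; case: X XR szn {ch} => [|a X] /=; last by lia.
by case: R => //= a R _; lia.
Qed.

(** [i] and [k] are the positions of the two occurrences of a factor T, [l] is the
    length of T, [j] the position of X0 and [m] the length of Xn. *)
Definition no_chain (w : word) : bool :=
  let n := size w in
  all (fun i => all (fun l => all (fun k =>
    if take l (drop i w) == take l (drop k w) then
      all (fun j => all (fun m =>
        ~~ chainb n (drop j (take i w)) (drop (i + l) (take k w))
                  (take m (drop (k + l) w)))
      (iota 0 (n - (k + l)).+1)) (iota 0 i.+1)
    else true)
  (iota (i + l) (n - (i + l + l)).+1)) (iota 2 (n - i))) (iota 0 n.+1).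

Lemma V_no_chain : all no_chain V.
Proof. by vm_compute. Qed.

Lemma no_chainP p X0 T m Xn q : 2 <= size T ->
  no_chain (p ++ X0 ++ T ++ m ++ T ++ Xn ++ q) -> ~ chain X0 m Xn.
Proof.
move=> T2 nc ch.
set w := p ++ _ in nc; set i := size p + size X0; set k := i + size T + size m.
have szw : size w = k + size T + size Xn + size q.
  by rewrite /k /i !size_cat; lia.
have wi : w = (p ++ X0) ++ T ++ m ++ T ++ Xn ++ q by rewrite /w -!catA.
have wk : w = ((p ++ X0 ++ T) ++ m) ++ T ++ Xn ++ q by rewrite /w -!catA.
have si : size (p ++ X0) = i by rewrite size_cat.
have siT : size (p ++ X0 ++ T) = i + size T by rewrite !size_cat addnA.
have sk : size ((p ++ X0 ++ T) ++ m) = k by rewrite size_cat siT.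
have di : drop i w = T ++ m ++ T ++ Xn ++ q by rewrite wi drop_size_cat.
have dk : drop k w = T ++ Xn ++ q by rewrite wk drop_size_cat.
have ti : take i w = p ++ X0 by rewrite wi take_size_cat.
have tk : take k w = (p ++ X0 ++ T) ++ m by rewrite wk take_size_cat.
have dkT : drop (k + size T) w = Xn ++ q.
  by rewrite addnC -drop_drop dk drop_size_cat.
move: nc => /allP/(_ i); rewrite mem_iota => /(_ _)/allP nc.
have {nc} := nc _ (size T); rewrite mem_iota => /(_ _ _)/allP nc.
have {nc} := nc _ _ k; rewrite mem_iota di dk.
rewrite !(take_size_cat _ (erefl (size T))) eqxx.
move=> /(_ _ _ _)/allP nc; have {nc} := nc _ _ _ (size p); rewrite mem_iota.
move=> /(_ _ _ _ _)/allP nc; have {nc} := nc _ _ _ _ (size Xn); rewrite mem_iota.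
rewrite ti tk dkT !drop_size_cat // take_size_cat // chain_chainb //; last first.
  by rewrite szw /k; lia.
rewrite szw /k /i => h; apply: notF; apply: h;
  rewrite ?add0n ?leq0n ?ltnS ?leq_addr ?T2 //=.
all: clear; lia.
Qed.

(** The only factor of length at least two that occurs twice in a word of V is xy
    or yx, and there the word in between is never a chain. *)
Lemma subword_no_chain X0 T m Xn : 2 <= size T ->
  subword V (X0 ++ T ++ m ++ T ++ Xn) -> ~ chain X0 m Xn.
Proof.
move=> T2 /orP[/eqP/(congr1 size)/eqP|/hasP[w wV /infixP[p [q wE]]]].
  by rewrite !size_cat !addn_eq0; case: (size T) T2 => // ? _; rewrite andbF.
have := allP V_no_chain w wV; rewrite wE -!catA; exact: no_chainP.
Qed.

Lemma subst_w_trivial phi p q n : subword V (subst phi (w_pattern p q n)) ->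
  phi p = [::] \/ phi q = [::].
Proof.
rewrite subst_w_pattern.
rewrite [X in subword V X](_ : _ = phi 6 ++ (phi 2 ++ (phi p ++ phi q) ++ phi 3) ++
  flatten [seq phi (6 + i) ++ phi (6 + i.-1) | i <- iota 1 n] ++
  (phi 2 ++ (phi p ++ phi q) ++ phi 3) ++ phi (6 + n)); last by rewrite -!catA.
case pE: (phi p) => [|a s]; first by left.
case qE: (phi q) => [|b t]; first by right.
move=> /subword_no_chain []; first by rewrite !size_cat /=; lia.
exact: (iota_chain (fun i => phi (6 + i)) 0 n).
Qed.

Lemma V_counts : all (fun w => all (fun a => count_mem a w <= 2) w) V.
Proof. by vm_compute. Qed.

Lemma subword_count s a : subword V s -> count_mem a s <= 2.
Proof.
case/orP=> [/eqP->//|/hasP[w wV /infixP[p [q wE]]]].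
have [aw|/count_memPn] := boolP (a \in w); last by rewrite wE !count_cat; lia.
have := allP (allP V_counts w wV) a aw; rewrite wE !count_cat; lia.
Qed.

Lemma subst_thrice phi u x :
  3 <= count_mem x u -> subword V (subst phi u) -> phi x = [::].
Proof.
case pE: (phi x) => [//|a s] x3 /(@subword_count _ a); rewrite leqNgt => /negP[].
apply: leq_trans x3 _; elim: u => //= b u IH.
rewrite -[subst phi _]/(phi b ++ subst phi u) count_cat; apply: leq_add => //.
by case: eqP => // ->; rewrite pE /= eqxx.
Qed.

Lemma Sigma_sound e : Sigma e -> satisfies (rees_monoid V) e.
Proof.
case=> [n n2|||]; apply/satisfies_reesP => phi sub.
- have {sub} : phi 0 = [::] \/ phi 1 = [::].
    by case/orP: sub => /subst_w_trivial; tauto.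
  by rewrite !subst_w_pattern => -[]->; rewrite !cats0.
- have {sub} : phi 0 = [::] by case/orP: sub => /(@subst_thrice _ _ 0); apply.
  by rewrite /subst /= => ->.
- have {sub} : phi 0 = [::] by case/orP: sub => /(@subst_thrice _ _ 0); apply.
  by rewrite /subst /= => ->.
- have {sub} : phi 0 = [::] by case/orP: sub => /(@subst_thrice _ _ 0); apply.
  by rewrite /subst /= => ->.
Qed.

Lemma eqv_sound u v : eqv u v -> satisfies (rees_monoid V) (u, v).
Proof. by apply; apply: Sigma_sound. Qed.

(** * Exchanging two letters *)

(** x and y are the letters 0 and 1; the letters of the pattern are shifted. *)
Definition pattern_word (g : pattern) : word :=
  let up := map (fun i => i.+2) in
  up g.1.1 ++ [:: 0; 1] ++ up g.1.2 ++ [:: 0; 1] ++ up g.2.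

Lemma obstruction_pattern g : g \in obstructions ->
  let w := pattern_word g in
  V_pattern w /\ (forall i, i \in w -> 2 <= count_mem i w).
Proof.
have : all (fun w => V_pattern w && all (fun i => 2 <= count_mem i w) w)
           (map pattern_word obstructions).
  by vm_compute.
by move=> /allP h gO w; have /h/andP[wV /allP w2] := map_f pattern_word gO.
Qed.

Definition flips (u v : word) x y :=
  filter (mem [:: x; y]) u <> filter (mem [:: x; y]) v.

Definition limited2 (u : word) := forall a, count_mem a u <= 2.

Lemma flip_critical u v (x y : nat) (A B C : word) :
  satisfies (rees_monoid V) (u, v) -> limited2 u -> flips u v x y ->
  u = A ++ [:: x; y] ++ B ++ [:: x; y] ++ C ->
  critical A B C.
Proof.
move=> sat u2 fl uE.
have sub : subseq (A ++ B ++ C) u.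
  rewrite uE; apply: cat_subseq => //; do 2![apply: subseq_skip].
  by apply: cat_subseq => //; do 2!apply: subseq_skip.
have cntE (a : nat) :
    count_mem a u = count_mem a (A ++ B ++ C) + (x == a).*2 + (y == a).*2.
  by rewrite uE !count_cat /=; lia.
have once (a : nat) : count_mem a (A ++ B ++ C) = 1 -> count_mem a u = 1.
  by move=> c1; have := u2 a; rewrite cntE c1; do 2!case: eqP.
have noP (t : nat) (p : word) (f : nat -> nat) :
    V_pattern p -> all (fun i => (i == t) || (2 <= count_mem i p)) p ->
    count_mem (f t) u <= count_mem t p -> subseq (map f p) u ->
    x \in map f p -> y \in map f p -> False.
  move=> isop /allP p2 ft pu; apply: (no_pattern sat fl isop pu) => i /p2.
  by case/predU1P=> [->//|]; apply: leq_trans.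
split.
- by move=> a; apply: leq_trans (u2 a); rewrite cntE -addnA leq_addr.
- move=> a aB; have := u2 a; rewrite cntE => c2.
  have [c1|] := eqVneq (count_mem a (A ++ B ++ C)) 1; last first.
    have : 0 < count_mem a (A ++ B ++ C).
      by rewrite -has_count has_pred1 !mem_cat aB orbT.
    by move: c2; lia.
  exfalso; apply: (noP 2 [:: 0; 1; 2; 0; 1] (nth 0 [:: x; y; a]));
    rewrite /= ?(once _ c1) // ?inE ?eqxx ?orbT //.
  by rewrite uE; find_subseq.
- move=> a t aB t1; apply/negP => aT.
  apply: (noP 3 [:: 2; 3; 0; 1; 2; 0; 1] (nth 0 [:: x; y; a; t]));
    rewrite /= ?(once _ t1) // ?inE ?eqxx ?orbT //.
  by rewrite uE; find_subseq.
- move=> a t aB t1; apply/negP => aT.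
  apply: (noP 3 [:: 0; 1; 2; 0; 1; 3; 2] (nth 0 [:: x; y; a; t]));
    rewrite /= ?(once _ t1) // ?inE ?eqxx ?orbT //.
  by rewrite uE; find_subseq.
move=> g f gF s1 s2 s3; have [isog g2] := obstruction_pattern gF.
pose f' i := if i is j.+2 then f j else nth 0 [:: x; y] i.
have upE (s : word) : map f' (map (fun i => i.+2) s) = map f s by rewrite -map_comp.
apply: (noP 0 (pattern_word g) f') => //.
- by apply/allP => i ig; rewrite g2 ?orbT.
- by apply: leq_trans (u2 _) (g2 0 _); rewrite /pattern_word mem_cat inE eqxx !orbT.
- rewrite /pattern_word !map_cat !upE uE /=; apply: cat_subseq => //.
  by do 2!apply: subseq_keep; apply: cat_subseq => //; do 2!apply: subseq_keep.
- by rewrite /pattern_word !map_cat !upE /= !(mem_cat, inE) eqxx !orbT.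
- by rewrite /pattern_word !map_cat !upE /= !(mem_cat, inE) eqxx !orbT.
Qed.

(** The letters outside the images of the letters of w_n are A' and C'. *)
Lemma critical_swap x y A B C : critical A B C ->
  eqv (A ++ [:: x; y] ++ B ++ [:: x; y] ++ C)
      (A ++ [:: y; x] ++ B ++ [:: y; x] ++ C).
Proof.
move=> /critical_tight[A' [P [Q [C' [-> -> /tight_decomposition]]]]].
move=> [X0 [Z1 [Z2 [mid [Xn [-> -> -> ch m0]]]]]].
have := eqv_cat (eqv_refl A') (eqv_cat (eqv_chain x y Z1 Z2 ch m0) (eqv_refl C')).
by rewrite -!catA.
Qed.

Lemma satisfies_sym u v :
  satisfies (rees_monoid V) (u, v) -> satisfies (rees_monoid V) (v, u).
Proof. by move=> sat theta; rewrite -[LHS](sat theta). Qed.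

Lemma limited2_perm u v : perm_eq u v -> limited2 u -> limited2 v.
Proof. by move=> /permP uv u2 a; rewrite -uv. Qed.

(** Any other two-letter restriction would be the same in [u] and [v]. *)
Lemma alternating u v b c : satisfies (rees_monoid V) (u, v) -> perm_eq u v ->
  limited2 u -> b != c -> b \in u -> c \in u -> flips u v b c ->
  (filter (mem [:: b; c]) u = [:: b; c; b; c] /\
   filter (mem [:: b; c]) v = [:: c; b; c; b]) \/
  (filter (mem [:: b; c]) u = [:: c; b; c; b] /\
   filter (mem [:: b; c]) v = [:: b; c; b; c]).
Proof.
move=> sat uv u2 bc bu cu fl.
have v2 := limited2_perm uv u2.
have := two_letters sat bc bu cu (u2 b) (u2 c) fl.
have bv : b \in v by rewrite -(perm_mem uv).
have cv : c \in v by rewrite -(perm_mem uv).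
have := two_letters (satisfies_sym sat) bc bv cv (v2 b) (v2 c) (nesym fl).
by case=> fv; case=> fu; move: fl; rewrite /flips fu fv; tauto.
Qed.

Lemma count_filter_mem (a : nat) (L s : word) : a \in L ->
  count_mem a (filter (mem L) s) = count_mem a s.
Proof.
move=> aL; rewrite count_filter; apply: eq_count => b /=.
by case: eqP => // ->.
Qed.

Lemma first_occurrence (a : nat) (s : word) : a \in s ->
  exists s1 s2, s = s1 ++ a :: s2 /\ a \notin s1.
Proof.
rewrite -has_pred1 => as_; case/split_find: as_ => a' s1 s2 /eqP-> na.
by exists s1, s2; rewrite cat_rcons -has_pred1.
Qed.

(** Let z be the first letter of D.  If z occurs before the second x, then x, y, z
    form xyzyxz or zxyzyx up to renaming.  Otherwise both x precede every z in u,
    hence also in v; there both y then precede the first z, as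
    yxyx ends with x, but z stands between the two y in u. *)
Lemma flip_no_gap u v (x y : nat) (A B D C : word) :
  satisfies (rees_monoid V) (u, v) -> perm_eq u v -> limited2 u -> x != y ->
  filter (mem [:: x; y]) u = [:: x; y; x; y] ->
  filter (mem [:: x; y]) v = [:: y; x; y; x] ->
  u = A ++ [:: x; y] ++ B ++ x :: D ++ y :: C -> D = [::].
Proof.
move=> sat uv u2 xy fu fv uE; case: D => [//|z D] in uE *; exfalso.
have fl : flips u v x y by rewrite /flips fu fv => -[xy']; rewrite xy' eqxx in xy.
have v2 := limited2_perm uv u2.
have thr (a : nat) := not_thrice (u2 a); rewrite uE in thr.
have xA : x \notin A by apply/negP => xA; case/negP: (thr x); find_subseq.
have yA : y \notin A by apply/negP => yA; case/negP: (thr y); find_subseq.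
have xB : x \notin B by apply/negP => xB; case/negP: (thr x); find_subseq.
have yB : y \notin B by apply/negP => yB; case/negP: (thr y); find_subseq.
have zx : z != x by apply/eqP => zx; case/negP: (thr x); rewrite zx; find_subseq.
have zy : z != y by apply/eqP => zy; case/negP: (thr y); rewrite zy; find_subseq.
have noP (p : word) : V_pattern p -> all (fun i => 2 <= count_mem i p) p ->
    subseq (map (nth 0 [:: x; y; z]) p) u -> 0 \in p -> 1 \in p -> False.
  move=> isop /allP p2 pu p0 p1; apply: (no_pattern sat fl isop pu).
  - by move=> i /p2; apply: leq_trans.
  - by apply/mapP; exists 0.
  - by apply/mapP; exists 1.
have zA : z \notin A.
  apply/negP => zA; apply: (noP [:: 2; 0; 1; 0; 2; 1]) => //.
  by rewrite uE /=; find_subseq.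
have zB : z \notin B.
  apply/negP => zB; apply: (noP [:: 0; 1; 2; 0; 2; 1]) => //.
  by rewrite uE /=; find_subseq.
have skip (a b : nat) (s : word) :
    a \notin s -> b \notin s -> filter (mem [:: a; b]) s = [::].
  move=> aS bS; apply/eqP; rewrite -(negbK (_ == _)) -has_filter.
  apply/hasPn => c cs.
  by rewrite !inE negb_or; apply/andP; split; apply: contraTneq cs => ->.
have mem_u (a : nat) : a \in [:: x; y; z] -> a \in u.
  by rewrite uE !inE !(mem_cat, inE) => /or3P[]->; rewrite ?orbT.
have [rest fuxz] : exists rest, filter (mem [:: x; z]) u = [:: x, x, z & rest].
  rewrite uE !filter_cat (skip x z A) // (skip x z B) //= !inE !eqxx !orbT.
  by rewrite (negbTE (_ : y != x)) ?(eq_sym y) ?(negbTE xy) ?(negbTE zy) /=; eexists.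
have [rest' fuyz] : exists rest, filter (mem [:: y; z]) u = [:: y, z & rest].
  rewrite uE !filter_cat (skip y z A) // (skip y z B) //= !inE !eqxx !orbT.
  by rewrite (negbTE xy) (eq_sym x) (negbTE zx) /=; eexists.
have fvxz : filter (mem [:: x; z]) v = [:: x, x, z & rest].
  have [<-//|/eqP fl'] :=
    eqVneq (filter (mem [:: x; z]) u) (filter (mem [:: x; z]) v).
  rewrite eq_sym in zx.
  have [||[]|[]] := alternating sat uv u2 zx _ _ fl';
    rewrite ?mem_u ?inE ?eqxx ?orbT // fuxz => -[] xz *; rewrite xz eqxx in zx => //.
have [V1 [V2 [vE zV1]]] : exists V1 V2, v = V1 ++ z :: V2 /\ z \notin V1.
  by apply: first_occurrence; rewrite -(perm_mem uv) mem_u ?inE ?eqxx ?orbT.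
(* both x, and then both y, precede the first z in v *)
have xV1 : 2 <= count_mem x V1.
  rewrite -(@count_filter_mem x [:: x; z]) ?inE ?eqxx //.
  move: fvxz; rewrite vE filter_cat /= !inE eqxx orbT.
  case: (filter _ V1) => [|a1 [|a2 s]] /= [].
  - by move=> /eqP; rewrite (negbTE zx).
  - by move=> _ /eqP; rewrite (negbTE zx).
  - by move=> -> -> _; rewrite !eqxx.
have yV1 : 2 <= count_mem y V1.
  rewrite -(@count_filter_mem y [:: x; y]) ?inE ?eqxx ?orbT //.
  move: xV1; rewrite -(@count_filter_mem x [:: x; y]) ?inE ?eqxx //.
  move: fv; rewrite vE filter_cat; move: (filter _ (z :: V2)) => s.
  have yx : (y == x) = false by rewrite eq_sym (negbTE xy).
  case: (filter _ V1) => [|a1 [|a2 [|a3 [|a4 [|? ?]]]]] //= [].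
  - by move=> ->; rewrite yx.
  - by move=> -> -> _; rewrite yx eqxx.
  - by move=> -> -> -> _; rewrite yx eqxx.
  - by move=> -> -> -> -> _; rewrite eqxx yx eqxx (negbTE xy).
have [s fvyz] : exists s, filter (mem [:: y; z]) v = [:: y, y & s].
  rewrite vE filter_cat; move: yV1.
  rewrite -(@count_filter_mem y [:: y; z]) ?inE ?eqxx //.
  have : {subset filter (mem [:: y; z]) V1 <= pred1 y}.
    move=> a; rewrite mem_filter !inE => /andP[/orP[//|/eqP->] aV].
    by rewrite aV in zV1.
  case: (filter _ V1) => [|a1 [|a2 s]] // sub; first by rewrite /=; case: eqP.
  have /eqP-> := sub a1 (mem_head _ _).
  have /eqP-> : a2 \in pred1 y by apply: sub; rewrite !inE eqxx orbT.
  by eexists.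
have fl' : flips u v y z.
  by rewrite /flips fuyz fvyz => -[zy' _]; rewrite zy' eqxx in zy.
rewrite eq_sym in zy.
have [||[]|[]] := alternating sat uv u2 zy _ _ fl';
  rewrite ?mem_u ?inE ?eqxx ?orbT // fvyz => _ [yz *];
  by rewrite yz eqxx in zy.
Qed.

(** * Sorting *)

(** The letters [c] and [b] are ordered differently in [u] and [v], hence
    alternate; as [p] is common to [u] and [v], neither of them occurs in it, so
    that the adjacent occurrences [c :: b] are the first ones. *)
Lemma flip_blocks u v (b c : nat) (p q r s : word) :
  satisfies (rees_monoid V) (u, v) -> perm_eq u v -> limited2 u -> b \notin rcons q c ->
  u = p ++ q ++ c :: b :: r -> v = p ++ b :: s ->
  exists B C, r = B ++ [:: c; b] ++ C /\ critical (p ++ q) B C.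
Proof.
move=> sat uv u2 bq uE vE.
have [cb bq'] : c != b /\ b \notin q.
  by move: bq; rewrite mem_rcons inE negb_or eq_sym => /andP[].
pose pr := filter (mem [:: c; b]).
have fuE : pr u = pr p ++ pr q ++ c :: b :: pr r.
  by rewrite uE /pr !filter_cat /= !inE !eqxx orbT.
have fvE : pr v = pr p ++ b :: pr s.
  by rewrite vE /pr !filter_cat /= !inE !eqxx orbT.
have prq : b \notin pr q by rewrite mem_filter (negbTE bq') andbF.
have fl : flips u v c b.
  rewrite /flips -/(pr u) -/(pr v) fuE fvE => /eqP; rewrite eqseq_cat // eqxx /=.
  case: (pr q) prq => [_|a t]; first by rewrite eqseq_cons (negbTE cb).
  by rewrite inE negb_or eq_sym cat_cons eqseq_cons => /andP[/negbTE-> _].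
have cu : c \in u by rewrite uE !(mem_cat, inE) eqxx !orbT.
have bu : b \in u by rewrite uE !(mem_cat, inE) eqxx !orbT.
have [fu fv prp prq0] : [/\ pr u = [:: c; b; c; b], pr v = [:: b; c; b; c],
                            pr p = [::] & pr q = [::]].
  have := alternating sat uv u2 cb cu bu fl; rewrite -!/(pr _) fuE fvE.
  move: (pr p) (pr q) prq (pr r) (pr s) => p' q' bq0 r' s'.
  move/eqP: (cb) => cb'; case: q' bq0 => [_|a q'].
    by case: p' => [|a1 [|a2 [|a3 p']]] /= [] [fu fv];
      first [by split | exfalso; congruence
            | move/(congr1 size): fu; rewrite /= size_cat /= !addnS].
  rewrite inE negb_or => /andP[/eqP ba bq0].
  have {}bq0 : b <> head c q'.
    case: q' bq0 => [_|a' q' /=]; first exact: nesym.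
    by rewrite inE negb_or => /andP[/eqP].
  by case: q' bq0 => [|a' q'] /= ba'; case: p' => [|a1 [|a2 p']] /= [] [fu fv];
    first [exfalso; congruence
          | move/(congr1 size): fu; rewrite /= !size_cat /= !addnS].
have prr : pr r = [:: c; b] by move: fuE; rewrite fu prp prq0 => -[<-].
have [r1 [r2 rE]] : exists r1 r2, r = r1 ++ c :: r2.
  have : c \in pr r by rewrite prr mem_head.
  by rewrite mem_filter => /andP[_]; case/splitPr=> r1 r2; exists r1, r2.
have br2 : b \in r2.
  have : b \in pr r2; last by rewrite mem_filter => /andP[].
  move: prr; rewrite rE /pr filter_cat /= !inE eqxx -/pr.
  case: (pr r1) => [|a [|a2 t]] /= [].
  - by move=> ->; rewrite mem_head.
  - by move=> _ /eqP; rewrite (negbTE cb).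
  - by move=> _ _ /(congr1 size); rewrite size_cat /= addnS.
have [D [C r2E]] : exists D C, r2 = D ++ b :: C.
  by case/splitPr: br2 => D C; exists D, C.
have {}uE : u = (p ++ q) ++ [:: c; b] ++ r1 ++ c :: D ++ b :: C.
  by rewrite uE rE r2E -!catA.
have D0 := flip_no_gap sat uv u2 cb fu fv uE; rewrite D0 in r2E uE.
exists r1, C; split; first by rewrite rE r2E.
exact: flip_critical sat u2 fl uE.
Qed.

(** The letter [b] passes the letters of [q] from right to left.  Each exchange is
    a consequence of Sigma, so by soundness M(V) still satisfies the identity. *)
Lemma move_left u v (b : nat) (p q r s : word) :
  satisfies (rees_monoid V) (u, v) -> perm_eq u v -> limited2 u ->
  b \notin q -> u = p ++ q ++ b :: r -> v = p ++ b :: s ->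
  exists2 r', eqv u (p ++ b :: r') & perm_eq u (p ++ b :: r').
Proof.
move=> sat uv u2 + + vE.
elim/last_ind: q => [|q c IH] in u r sat uv u2 * => bq uE.
  by exists r; rewrite uE //; apply: eqv_refl.
rewrite cat_rcons in uE.
have [B [C [rE cr]]] := flip_blocks sat uv u2 bq uE vE.
pose u' := p ++ q ++ b :: c :: B ++ [:: b; c] ++ C.
have uu' : eqv u u'.
  by rewrite uE rE /u'; have := critical_swap c b cr; rewrite -!catA.
have puu' : perm_eq u u'.
  apply/permP => a; rewrite uE rE /u' !count_cat /= !count_cat /=; lia.
have [|||||r' u'r' pr'] := IH u' (c :: B ++ [:: b; c] ++ C).
- have := eqv_sound (eqv_sym uu') => sat' theta.
  by rewrite [LHS](sat' theta); apply: sat.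
- by apply: perm_trans uv; rewrite perm_sym.
- exact: limited2_perm puu' u2.
- by move: bq; rewrite mem_rcons inE negb_or => /andP[].
- by [].
by exists r'; [apply: eqv_trans uu' u'r' | apply: perm_trans puu' pr'].
Qed.

(** [u] agrees with [v] on a prefix [p], which is extended letter by letter. *)
Lemma limited2_complete u v : satisfies (rees_monoid V) (u, v) ->
  perm_eq u v -> limited2 u -> eqv u v.
Proof.
move=> sat uv u2.
have : exists p t s, [/\ eqv u (p ++ t), perm_eq u (p ++ t) & v = p ++ s].
  by exists [::], u, v.
move=> [p [t [s [ut put vE]]]].
elim: s => [|b s IH] in p t ut put vE *.
  suff -> : v = p ++ t by [].
  suff : size t = 0 by case: t {ut put} => //; rewrite vE.
  have := perm_size uv; rewrite (perm_size put) vE !size_cat /=; lia.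
have ptv : perm_eq (p ++ t) v by apply: perm_trans uv; rewrite perm_sym.
have bt : b \in t.
  by move: ptv; rewrite vE perm_cat2l => /perm_mem ->; rewrite mem_head.
have [q [r [tE bq]]] := first_occurrence bt; rewrite {}tE {bt} in ut put ptv.
have [||r' u'r' pr'] :=
  @move_left (p ++ q ++ b :: r) v b p q r s _ ptv _ bq erefl vE.
- by move=> theta; rewrite -[LHS](eqv_sound ut theta); apply: sat.
- exact: limited2_perm put u2.
apply: (IH (rcons p b) r'); rewrite ?cat_rcons //.
  exact: eqv_trans ut u'r'.
exact: perm_trans put pr'.
Qed.

(** * Letters occurring at least three times *)

Lemma cube_central (x : nat) w : eqv ([:: x; x; x] ++ w) (w ++ [:: x; x; x]).
Proof.
(* t1 and t2 are the letters 4 and 5 *)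
have := eqv_instance
  (fun k => if k == 0 then [:: x] else if k == 4 then w else [::]) Sigma_xxxtt.
by rewrite /subst /= !cats0.
Qed.

Lemma cube_absorb (x : nat) : eqv [:: x; x; x; x] [:: x; x; x].
Proof.
by have := eqv_sym (eqv_instance (fun=> [:: x]) Sigma_x3x4).
Qed.

Lemma cube_filter (x : nat) w :
  eqv ([:: x; x; x] ++ w) ([:: x; x; x] ++ filter (predC1 x) w).
Proof.
elim: w => [|a w IH] /=; first exact: eqv_refl.
have [->|ax] := eqVneq a x.
  apply: eqv_trans IH; exact: (eqv_cat (cube_absorb x) (eqv_refl w)).
apply: (@eqv_trans ([:: a] ++ [:: x; x; x] ++ w)).
  have := eqv_cat (cube_central x [:: a]) (eqv_refl w); by rewrite -!catA.
apply: (@eqv_trans ([:: a] ++ [:: x; x; x] ++ filter (predC1 x) w)).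
  exact: (eqv_cat (eqv_refl [:: a]) IH).
have := eqv_cat (eqv_sym (cube_central x [:: a])) (eqv_refl (filter (predC1 x) w)).
by rewrite -!catA.
Qed.

(** The identity xt1xt2x = x^3t1t2 joins the first three occurrences of x, and the
    cube absorbs all others on its way through the word. *)
Lemma gather_cube (x : nat) w : 3 <= count_mem x w ->
  eqv w ([:: x; x; x] ++ filter (predC1 x) w).
Proof.
have split1 (s : word) :
    0 < count_mem x s -> exists s1 s2, s = s1 ++ x :: s2 /\ x \notin s1.
  by rewrite -has_count has_pred1; apply: first_occurrence.
move=> w3; have [A [w1 [wE xA]]] := split1 w (ltn_trans (isT : 0 < 2) w3).
have c0 (s : word) : x \notin s -> count_mem x s = 0 by move/count_memPn.
rewrite wE count_cat /= eqxx (c0 A xA) add0n add1n ltnS in w3.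
have [B [w2 [w1E xB]]] := split1 w1 (ltn_trans (isT : 0 < 1) w3).
rewrite w1E count_cat /= eqxx (c0 B xB) add0n add1n ltnS in w3.
have [C [D [w2E xC]]] := split1 w2 w3.
have phi : eqv (x :: B ++ x :: C ++ [:: x]) ([:: x; x; x] ++ B ++ C).
  have := eqv_instance (nth [::] [:: [:: x]; [::]; [::]; [::]; B; C]) Sigma_xtxtx.
  by rewrite /subst /= !cats0.
have E : eqv w (A ++ [:: x; x; x] ++ B ++ C ++ D).
  rewrite wE w1E w2E; have := eqv_cat (eqv_refl A) (eqv_cat phi (eqv_refl D)).
  by rewrite /= -!catA /= -!catA.
apply: (eqv_trans E).
apply: (@eqv_trans ([:: x; x; x] ++ A ++ B ++ C ++ D)).
  have := eqv_cat (eqv_sym (cube_central x A)) (eqv_refl (B ++ C ++ D)).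
  by rewrite -!catA.
apply: (eqv_trans (cube_filter x _)).
rewrite wE w1E w2E !filter_cat /= eqxx /= !filter_cat /= eqxx /=.
rewrite !filter_cat /= eqxx /=.
exact: eqv_refl.
Qed.

Lemma satisfies_filter u v x : satisfies (rees_monoid V) (u, v) ->
  satisfies (rees_monoid V) (filter (predC1 x) u, filter (predC1 x) v).
Proof.
move=> /satisfies_reesP sat; apply/satisfies_reesP => phi.
pose psi a := if a == x then [::] else phi a.
have E w : subst phi (filter (predC1 x) w) = subst psi w.
  elim: w => //= a w IH; rewrite -[RHS]/(psi a ++ subst psi w) -IH /psi.
  by case: (a == x).
by rewrite !E; apply: sat.
Qed.

(** The words x and xx are factors of V. *)
Lemma satisfies_count u v x : satisfies (rees_monoid V) (u, v) ->
  count_mem x u <= 2 -> count_mem x v = count_mem x u.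
Proof.
move=> /satisfies_reesP sat u2.
(* [6] is the letter x in V *)
pose phi a : word := if a == x then [:: 6] else [::].
have cntE w : size (subst phi w) = count_mem x w.
  elim: w => //= a w <-; rewrite -[subst _ (a :: w)]/(phi a ++ subst phi w) size_cat.
  by rewrite {1}/phi; case: (a == x).
rewrite -!cntE (sat _) //.
have -> : subst phi u = nseq (count_mem x u) 6.
  rewrite -cntE; elim: (u) => //= a w IH.
  rewrite -[subst _ (a :: w)]/(phi a ++ subst phi w) size_cat {1}IH {1 3}/phi.
  by case: (a == x).
by case: (count_mem x u) u2 => [|[|[|]]] // _; vm_compute.
Qed.

(** By induction on the length, removing a letter that occurs at least three
    times; by [satisfies_count] it does so in both words. *)
Lemma completeness u v : satisfies (rees_monoid V) (u, v) -> eqv u v.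
Proof.
have [n] := ubnP (size u); elim: n => // n IH in u v * => un sat.
have [/allP u2|] := boolP (all (fun a => count_mem a u <= 2) u).
  have {}u2 : limited2 u.
    by move=> a; have [/u2//|/count_memPn->] := boolP (a \in u).
  apply: limited2_complete => //; apply/allP => a _ /=; apply/eqP/esym.
  by apply: satisfies_count.
rewrite -has_predC => /hasP[x xu /=]; rewrite -ltnNge => u3.
have v3 : 2 < count_mem x v.
  rewrite ltnNge; apply/negP => v2.
  by move: u3; rewrite (satisfies_count (satisfies_sym sat) v2) ltnNge v2.
apply: (eqv_trans (gather_cube u3)).
apply: (eqv_trans _ (eqv_sym (gather_cube v3))).
apply: (eqv_cat (eqv_refl _)); apply: IH; last exact: satisfies_filter.
rewrite ltnS in un; apply: leq_trans un.
rewrite size_filter -(count_predC (predC1 x) u) -addn1 leq_add2l.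
by rewrite -has_count; apply/hasP; exists x => //=; rewrite negbK.
Qed.

Theorem theorem3p6 (u v : word) :
  satisfies (rees_monoid V) (u, v) <-> consequence Sigma (u, v).
Proof. by split; [apply: completeness | apply: eqv_sound]. Qed.
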